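(* Let $d=r$ (with $1\le d<p$), and consider the inverse regression model $\mathbf X_i=\boldsymbol\mu+\boldsymbol\Gamma\boldsymbol\beta\mathbf f_i+\sigma\boldsymbol\epsilon_i$, $i=1,\dots,n$, described in the context. Assume that all the entries of the error vectors $\boldsymbol\epsilon_1,\dots,\boldsymbol\epsilon_n$ are independent standard normal random variables. Let $\widehat{\boldsymbol\Gamma}_{\mathrm{PFC}}$ be the PFC estimator. Then, conditional on $\mathbf F^T\mathbf F$, $$\frac{(p-d)\,C(\widehat{\boldsymbol\Gamma}_{\mathrm{PFC}},\boldsymbol\Gamma)}{d}=\frac{(p-d)\,\|\mathbf P_{\boldsymbol\Gamma}\widehat{\boldsymbol\Gamma}_{\mathrm{PFC}}\|_F^2}{d\,\|(\mathbf I_p-\mathbf P_{\boldsymbol\Gamma})\widehat{\boldsymbol\Gamma}_{\mathrm{PFC}}\|_F^2}\;\sim\;F_{rd,\,r(p-d)}(\Lambda),$$ where $F_{rd,r(p-d)}(\Lambda)$ is the non-central $F$ distribution with $(rd,\,r(p-d))$ degrees of freedom and non-centrality parameter $\Lambda=\operatorname{tr}\big(\boldsymbol\beta(\mathbf F^T\mathbf F)\boldsymbol\beta^T\big)/\sigma^2$.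
   Context: Model. $n,p,d,r$ are positive integers with $d<p$ and $d\le r$. The parameters are $\boldsymbol\mu\in\mathbb R^p$, a $p\times d$ matrix $\boldsymbol\Gamma$ with $\boldsymbol\Gamma^T\boldsymbol\Gamma=\mathbf I_d$, a $d\times r$ matrix $\boldsymbol\beta$, and $\sigma>0$. The observations are $\mathbf X_i=\boldsymbol\mu+\boldsymbol\Gamma\boldsymbol\beta\mathbf f_i+\sigma\boldsymbol\epsilon_i\in\mathbb R^p$, $i=1,\dots,n$, where $\mathbf f_i\in\mathbb R^r$ are random vectors (functions of random responses) with $\sum_{i=1}^n\mathbf f_i=\mathbf 0$, and the errors $(\boldsymbol\epsilon_i)_{i\le n}$, with values in $\mathbb R^p$, are independent of $(\mathbf f_i)_{i\le n}$. Matrices. $\mathbb X$ is the $n\times p$ matrix with rows $(\mathbf X_i-\overline{\mathbf X})^T$, where $\overline{\mathbf X}=\frac1n\sum_i\mathbf X_i$; $\mathbf F$ is the $n\times r$ matrix with rows $\mathbf f_i^T$, assumed of full column rank $r$; $\mathbf E$ is the $n\times p$ matrix with rows $\sigma\boldsymbol\epsilon_i^T$. For a matrix $\mathbf G$ of full column rank, $\mathbf P_{\mathbf G}=\mathbf G(\mathbf G^T\mathbf G)^{-1}\mathbf G^T$. The fitted matrix is $\widehat{\mathbb X}=\mathbf P_{\mathbf F}\mathbb X$. $\|\mathbf A\|_F^2=\operatorname{tr}(\mathbf A^T\mathbf A)$. $(\mathbf F^T\mathbf F)^{1/2}$ is the symmetric positive definite square root. PFC estimator. $\widehat{\boldsymbol\Gamma}_{\mathrm{PFC}}$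 has as columns $d$ pairwise orthogonal eigenvectors of $\widehat{\mathbb X}^T\widehat{\mathbb X}$ corresponding to its $d$ largest eigenvalues. Scaling convention when $d=r$: $\widehat{\boldsymbol\Gamma}_{\mathrm{PFC}}=\mathbf V\mathbf O$ for an $r\times r$ orthogonal matrix $\mathbf O$, where $\mathbf V$ is the $p\times r$ matrix $\mathbf V=\mathbb X^T\mathbf F(\mathbf F^T\mathbf F)^{-1/2}$, which satisfies $\mathbf V\mathbf V^T=\widehat{\mathbb X}^T\widehat{\mathbb X}$ (the Frobenius norms below do not depend on $\mathbf O$). For a $p\times d$ matrix $\widehat{\boldsymbol\Gamma}$, $C(\widehat{\boldsymbol\Gamma},\boldsymbol\Gamma)=\|\mathbf P_{\boldsymbol\Gamma}\widehat{\boldsymbol\Gamma}\|_F^2\,/\,\|(\mathbf I_p-\mathbf P_{\boldsymbol\Gamma})\widehat{\boldsymbol\Gamma}\|_F^2$. The non-central $F_{a,b}(\Lambda)$ distribution is the law of $(U/a)/(W/b)$ with $U,W$ independent, $U$ non-central $\chi^2$ with $a$ degrees of freedom and non-centrality parameter $\Lambda$ (the sum of squared means), and $W$ central $\chi^2$ with $b$ degrees of freedom. *)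

(* Defs.v *)
From HB Require Import structures.
From mathcomp Require Import all_boot all_order all_algebra.
From mathcomp Require Import all_classical all_reals all_analysis.
From mathcomp Require Import measurable_realfun.

Set Implicit Arguments.
Unset Strict Implicit.
Unset Printing Implicit Defensive.

Import Order.TTheory GRing.Theory Num.Theory.

Local Open Scope classical_set_scope.
Local Open Scope ring_scope.

Section probability_notions.
Context {R : realType} {d : measure_display} {T : measurableType d}.
Variable P : probability T R.

Definition has_law (X : T -> R) (nu : set R -> \bar R) : Prop :=
  measurable_fun [set: T] X /\
  forall B : set R, measurable B -> P (X @^-1` B) = nu B.

(* Taking some of the B i equal to setT gives the product rule for every
   subfamily. *)
Definition mutually_independent (I : finType) (X : I -> T -> R) : Prop :=
  forall B : I -> set R, (forall i, measurable (B i)) ->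
    P (\bigcap_(i in [set: I]) (X i @^-1` B i)) =
    (\prod_(i in I) P (X i @^-1` B i))%E.

Definition independent_pair (X Y : T -> R) : Prop :=
  forall A B : set R, measurable A -> measurable B ->
    P (X @^-1` A `&` Y @^-1` B) = (P (X @^-1` A) * P (Y @^-1` B))%E.

Definition sigma_generated (I : Type) (X : I -> T -> R) : set (set T) :=
  <<s \bigcup_i g_sigma_algebra_preimage (X i) >>.

Definition independent_families (I J : Type)
    (X : I -> T -> R) (Y : J -> T -> R) : Prop :=
  forall A B : set T, sigma_generated X A -> sigma_generated Y B ->
    P (A `&` B) = (P A * P B)%E.

(* k is a regular conditional distribution of Y given the sub-sigma-algebra
   S. *)
Definition conditional_law (Y : T -> R) (S : set (set T))
    (k : T -> probability (measurableTypeR R) R) : Prop :=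
  [/\ measurable_fun [set: T] Y,
      forall B : set R, measurable B ->
        forall D : set (\bar R), measurable D ->
          S ((fun w => k w B) @^-1` D)
    & forall (A : set T) (B : set R), S A -> measurable B ->
        P (A `&` Y @^-1` B) = (\int[P]_(w in A) k w B)%E].

Definition entries (m n : nat) (M : T -> 'M[R]_(m, n)) :
    'I_m * 'I_n -> T -> R :=
  fun ij w => M w ij.1 ij.2.

End probability_notions.

Section distributions.
Context {R : realType} {d : measure_display} {T : measurableType d}.
Variable P : probability T R.

(* The law of U is described through variables Z i that may live on another
   probability space: Z i ~ N(m i, 1), and the non-centrality parameter L is
   the sum of the squared means. *)
Definition noncentral_chi2 (k : nat) (L : R) (U : T -> R) : Prop :=
  exists (d' : measure_display) (T' : measurableType d')
    (Q : probability T' R) (Z : 'I_k -> T' -> R) (m : 'I_k -> R),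
    [/\ forall i, has_law Q (Z i) (normal_prob (m i) 1),
        mutually_independent Q Z,
        \sum_i m i ^+ 2 = L
      & has_law P U (fun B => Q ((fun w => \sum_i Z i w ^+ 2) @^-1` B))].

Definition chi2 (k : nat) (W : T -> R) : Prop := noncentral_chi2 k 0 W.

End distributions.

Definition noncentral_F {R : realType} (a b : nat) (L : R)
    (nu : set R -> \bar R) : Prop :=
  exists (d : measure_display) (T : measurableType d)
    (P : probability T R) (U W : T -> R),
    [/\ noncentral_chi2 P a L U, chi2 P b W, independent_pair P U W
      & has_law P (fun w => (U w / a%:R) / (W w / b%:R)) nu].

Section matrices.
Context {R : realType}.

Definition rows_mx (n k : nat) (v : 'I_n -> 'cV[R]_k) : 'M[R]_(n, k) :=
  \matrix_(i < n, j < k) v i j 0.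

Definition sample_mean (n k : nat) (v : 'I_n -> 'cV[R]_k) : 'cV[R]_k :=
  n%:R^-1 *: \sum_i v i.

Definition centered_mx (n k : nat) (v : 'I_n -> 'cV[R]_k) : 'M[R]_(n, k) :=
  rows_mx (fun i => v i - sample_mean v).

Definition proj_col (m k : nat) (G : 'M[R]_(m, k)) : 'M[R]_m :=
  G *m invmx (G^T *m G) *m G^T.

Definition normF2 (m k : nat) (A : 'M[R]_(m, k)) : R := \tr (A^T *m A).

Definition fit_ratio (p d : nat) (Gh G : 'M[R]_(p, d)) : R :=
  normF2 (proj_col G *m Gh) / normF2 ((1%:M - proj_col G) *m Gh).

Definition is_spd_sqrt (k : nat) (S A : 'M[R]_k) : Prop :=
  [/\ S^T = S,
      forall v : 'cV[R]_k, v != 0 -> 0 < (v^T *m S *m v) 0 0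
    & S *m S = A].

(* The columns of G are pairwise orthogonal eigenvectors of M for its d
   largest eigenvalues, in any order.  The eigenvalues lam 0, ..., lam (p-1)
   are counted with multiplicity (as roots of the characteristic polynomial);
   only the separation between the first d of them and the others is
   required, so lam need not be sorted. *)
Definition leading_eigenvectors (p d : nat) (M : 'M[R]_p)
    (G : 'M[R]_(p, d)) : Prop :=
  exists lam : nat -> R,
    [/\ char_poly M = \prod_(i < p) ('X - (lam i)%:P),
        forall i k : nat, (i < d)%N -> (d <= k)%N -> (k < p)%N ->
          lam k <= lam i,
        forall j : 'I_d, col j G != 0 /\ M *m col j G = lam j *: col j G
      & forall i j : 'I_d, i != j -> (col i G)^T *m col j G = 0].

(* X is the centered data matrix.  The last clause fixes the scale of the
   eigenvectors when d = r; since d = r is only propositional there, O has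
   type 'M_(r, d) and its orthogonality is stated on both sides. *)
Definition is_PFC (n p d r : nat) (X : 'M[R]_(n, p)) (F : 'M[R]_(n, r))
    (Gh : 'M[R]_(p, d)) : Prop :=
  let Xhat := proj_col F *m X in
  leading_eigenvectors (Xhat^T *m Xhat) Gh /\
  (d = r -> exists (S : 'M[R]_r) (O : 'M[R]_(r, d)),
    [/\ is_spd_sqrt S (F^T *m F),
        O^T *m O = 1%:M, O *m O^T = 1%:M
      & Gh = X^T *m F *m invmx S *m O]).

End matrices.

(* Main.v *)
Require Import Defs.
From HB Require Import structures.
From mathcomp Require Import all_boot all_order all_algebra.
From mathcomp Require Import all_classical all_reals all_analysis.
From mathcomp Require Import measurable_realfun.
From mathcomp Require Import ring zify.

(* The PFC estimator is, up to an orthogonal factor, V = X^T F S^-1 with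
   S = (F^T F)^(1/2), and the model turns it into
     V = Gam bet S + sig E^T H,   H = F S^-1,   H^T H = 1.
   With B completing Gam to an orthogonal matrix, the two squared norms are
   those of bet S + sig Gam^T E^T H and sig B^T E^T H.  For fixed F, the
   entries of Gam^T E^T H and B^T E^T H are orthonormal combinations of the
   errors, hence i.i.d. standard normal, and a further rotation moves the mean
   bet S / sig onto one coordinate, where it is the square root of the
   non-centrality parameter.  So the law of the ratio given F depends on F^T F
   only, and independence of F and E makes it the conditional law.

   Rotation invariance of the Gaussian family is reduced to the plane: an
   orthonormal family is brought to unit vectors by plane reflections (Givens),
   and a plane reflection preserves N(0,1) x N(0,1) because it is a product of
   three shears and a swap of coordinates, which preserve Lebesgue measure. *)

Set Implicit Arguments.
Unset Strict Implicit.
Unset Printing Implicit Defensive.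

Import Order.TTheory GRing.Theory Num.Theory.

Local Open Scope classical_set_scope.
Local Open Scope ring_scope.

(** * Invariance of the planar Gaussian measure under reflections *)

Section planar_gaussian.
Context {R : realType}.
Local Notation leb := (@lebesgue_measure R).
Local Notation mR := (measurableTypeR R).
Local Notation leb2 := (leb \x leb)%E.
Local Notation N01 := (normal_prob (0 : R) 1).

(** Both measures give an interval []u, v]] its length, and this characterises Lebesgue measure. *)
Lemma lebesgue_measure_shift (a : R) (A : set R) : measurable A ->
  pushforward leb ((fun x => x + a) : _ -> measurableTypeR R) A = leb A.
Proof.
move=> mA.
have mf : measurable_fun setT ((fun x => x + a) : R -> measurableTypeR R).
  by apply: measurable_funD.
apply/esym/lebesgue_measure_unique => //= _ [[u v]] _ <-.
rewrite /pushforward.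
have -> : (fun x => x + a) @^-1` [set` `]u, v]] = [set` `]u - a, v - a]].
  by apply/seteqP; split => x /=; rewrite !in_itv/= ltrBlDr lerBrDr.
rewrite /= !lebesgue_measure_itv/= !lte_fin ltrD2r.
by case: ifP => // _; rewrite -!EFinB; congr EFin; ring.
Qed.

Lemma ge0_integral_shift (a : R) (f : R -> \bar R) :
  measurable_fun [set: R] f -> (forall x, 0 <= f x)%E ->
  (\int[leb]_x f (x + a)%R = \int[leb]_x f x)%E.
Proof.
move=> mf f0.
have mg : measurable_fun setT
    ((fun x => x + a) : measurableTypeR R -> measurableTypeR R).
  by apply: measurable_funD.
rewrite -[LHS](ge0_integral_pushforward mg leb (D := setT))//.
by apply: eq_measure_integral => A mA _; exact: lebesgue_measure_shift.
Qed.

Lemma measurable_swap_pair :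
  measurable_fun [set: mR * mR] (fun z : mR * mR => (z.2, z.1)).
Proof. exact: measurable_fun_pair. Qed.

Lemma measurable_shear (a : R) :
  measurable_fun [set: mR * mR] (fun z : mR * mR => (z.1 + a * z.2, z.2)).
Proof.
apply: measurable_fun_pair => //; apply: measurable_funD => //.
exact: measurable_funM.
Qed.

Lemma measurable_shear' (a : R) :
  measurable_fun [set: mR * mR] (fun z : mR * mR => (z.1, z.2 + a * z.1)).
Proof.
apply: measurable_fun_pair => //; apply: measurable_funD => //.
exact: measurable_funM.
Qed.

Lemma ge0_integral_leb2_swap (f : mR * mR -> \bar R) :
  measurable_fun [set: mR * mR] f -> (forall x, 0 <= f x)%E ->
  (\int[leb2]_z f (z.2, z.1) = \int[leb2]_z f z)%E.
Proof.
move=> mf f0.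
rewrite fubini_tonelli1//; last first.
  exact: (measurableT_comp mf measurable_swap_pair).
by rewrite fubini_tonelli2.
Qed.

(** For a fixed second coordinate the shear is a translation of the first one, so Tonelli reduces it
    to the one-dimensional shift. *)
Lemma ge0_integral_leb2_shear (a : R) (f : mR * mR -> \bar R) :
  measurable_fun [set: mR * mR] f -> (forall x, 0 <= f x)%E ->
  (\int[leb2]_z f ((z.1 + a * z.2)%R, z.2) = \int[leb2]_z f z)%E.
Proof.
move=> mf f0.
rewrite fubini_tonelli2//; last first.
  exact: (measurableT_comp mf (measurable_shear a)).
rewrite fubini_tonelli2//; apply: eq_integral => y _; rewrite /fubini_G/=.
rewrite (ge0_integral_shift (a * y) (f := fun x => f (x, y)))//.
exact: measurable_fun_pair1.
Qed.

Lemma ge0_integral_leb2_shear' (a : R) (f : mR * mR -> \bar R) :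
  measurable_fun [set: mR * mR] f -> (forall x, 0 <= f x)%E ->
  (\int[leb2]_z f (z.1, (z.2 + a * z.1)%R) = \int[leb2]_z f z)%E.
Proof.
move=> mf f0.
have mf' := measurableT_comp mf measurable_swap_pair.
rewrite -[RHS]ge0_integral_leb2_swap// -[RHS](ge0_integral_leb2_shear a)//.
rewrite -[RHS]ge0_integral_leb2_swap//.
exact: (measurableT_comp mf' (measurable_shear a)).
Qed.

(* With t the tangent of half the angle of the rotation (x, y) |-> (s x + c y,
   s y - c x), the reflection is a swap followed by a shear by t, a shear by -c
   and a shear by t. *)
Lemma ge0_integral_leb2_reflection (c s : R) (f : mR * mR -> \bar R) :
  c ^+ 2 + s ^+ 2 = 1 -> 0 <= s ->
  measurable_fun [set: mR * mR] f -> (forall x, 0 <= f x)%E ->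
  (\int[leb2]_z f ((c * z.1 + s * z.2)%R, (s * z.1 - c * z.2)%R) =
   \int[leb2]_z f z)%E.
Proof.
move=> cs s0 mf f0; pose t := c / (1 + s).
pose f1 z := f (z.1 + t * z.2, z.2)%R.
have mf1 : measurable_fun [set: mR * mR] f1.
  exact: (measurableT_comp mf (measurable_shear _)).
pose f2 z := f1 (z.1, z.2 - c * z.1)%R.
have mf2 : measurable_fun [set: mR * mR] f2.
  have := measurableT_comp mf1 (measurable_shear' (- c)).
  by apply: eq_measurable_fun => z _; rewrite /f2/= mulNr.
pose f3 z := f2 (z.1 + t * z.2, z.2)%R.
have mf3 : measurable_fun [set: mR * mR] f3.
  exact: (measurableT_comp mf2 (measurable_shear _)).
transitivity (\int[leb2]_z f3 (z.2, z.1))%E; last first.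
  rewrite ge0_integral_leb2_swap//; last by move=> x; exact: f0.
  rewrite ge0_integral_leb2_shear//; last by move=> x; exact: f0.
  under eq_integral do rewrite /f2 -mulNr.
  rewrite ge0_integral_leb2_shear'//; last by move=> x; exact: f0.
  by rewrite ge0_integral_leb2_shear.
apply: eq_integral => -[x y] _; rewrite /f3 /f2 /f1/=; congr f.
(* The bound [0 <= s] keeps the denominator of [t] nonzero. The half-angle relations [c * t = 1 - s]
   and [s * t = c - t] then identify both coordinates. *)
have s1 : 1 + s != 0 by rewrite gt_eqF// ltr_pwDl.
have ct : c * t = 1 - s.
  rewrite /t mulrA -expr2; have -> : c ^+ 2 = (1 - s) * (1 + s).
    by rewrite -(addrK (s ^+ 2) (c ^+ 2)) cs; ring.
  by rewrite mulfK.
have st : s * t = c - t by rewrite /t; field.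
congr pair.
  rewrite [X in _ = X](_ : _ = (y + t * x) * (1 - c * t) + t * x); last by ring.
  rewrite ct subKr mulrDl [t * x * s](_ : _ = s * t * x); last by ring.
  by rewrite st; ring.
rewrite [X in _ = X](_ : _ = x * (1 - c * t) - c * y); last by ring.
by rewrite ct; ring.
Qed.

Lemma normal_pdf01 (x : R) :
  normal_pdf 0 1 x = normal_peak 1 * expR (- (x ^+ 2) / 2).
Proof.
by rewrite normal_pdfE ?oner_neq0// /normal_fun subr0 expr1n.
Qed.

(** A translation in the integral of the density. It shows that [Z + m] with [Z] standard normal has
    the law N(m, 1) asked for by [noncentral_chi2]. *)
Lemma normal_probD (m : R) (B : set R) : measurable B ->
  normal_prob m 1 B = N01 ((fun x => x + m) @^-1` B).
Proof.
move=> mB; rewrite /normal_prob integral_mkcond [RHS]integral_mkcond.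
rewrite -[LHS](ge0_integral_shift m); first last.
- by move=> x; rewrite patchE; case: ifP => // _; rewrite lee_fin normal_pdf_ge0.
- apply/(measurable_restrictT _ _).1 => //.
  by apply/measurable_funTS/measurable_EFinP; exact: measurable_normal_pdf.
apply: eq_integral => x _; rewrite !patchE.
rewrite [x \in _](_ : _ = (x + m \in B))//.
case: ifP => // _.
by rewrite !normal_pdfE ?oner_neq0// /normal_fun addrK subr0.
Qed.

Lemma normal_prob_ge0E (B : set R) (m s : R) : normal_prob m s B =
  (\int[leb]_x (normal_pdf m s x * \1_B x)%:E)%E.
Proof.
rewrite /normal_prob integral_mkcond; apply: eq_integral => x _.
by rewrite patchE indicE; case: (x \in B); rewrite /= ?mulr1 ?mulr0.
Qed.

Let dens (z : mR * mR) := normal_pdf 0 1 z.1 * normal_pdf 0 1 z.2.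

Let mdens : measurable_fun [set: mR * mR] dens.
Proof.
by apply: measurable_funM; apply: measurableT_comp => //; exact: measurable_normal_pdf.
Qed.

Let dens_ge0 z : 0 <= dens z.
Proof. by rewrite mulr_ge0// normal_pdf_ge0. Qed.

(** The measure with density [dens] has the product values on rectangles, by Tonelli, and rectangles
    determine the product measure. *)
Lemma normal_prob2E (C : set (mR * mR)) : measurable C ->
  (N01 \x N01)%E C = (\int[leb2]_(z in C) (dens z)%:E)%E.
Proof.
move=> mC.
pose nu (D : set (mR * mR)) := (\int[leb2]_(z in D) (dens z)%:E)%E.
have nu0 : nu set0 = 0%E by rewrite /nu integral_set0.
have nu_ge0 A : (0 <= nu A)%E by apply: integral_ge0 => z _; rewrite lee_fin.
have nu_add : semi_sigma_additive nu.
  have := @semi_sigma_additive_nng_induced _ _ R leb2 (EFin \o dens).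
  by apply=> // ; exact/measurable_EFinP.
pose nuM := isMeasure.Build _ _ _ nu nu0 nu_ge0 nu_add.
pose nuP : {measure set (mR * mR) -> \bar R} := HB.pack nu nuM.
rewrite (@product_measure_unique _ _ _ _ _ N01 N01 nuP)// => A B mA mB.
rewrite /= /nu integral_mkcond.
rewrite (eq_integral (fun z : mR * mR => ((normal_pdf 0 1 z.1 * \1_A z.1) *
   (normal_pdf 0 1 z.2 * \1_B z.2))%:E)); last first.
  move=> -[x y] _; rewrite patchE in_setX/= !indicE /dens/=.
  by case: (x \in A); case: (y \in B); rewrite /= ?mulr0 ?mul0r ?mulr1.
have mN (D : set R) : measurable D ->
    measurable_fun [set: R] (fun x : R => normal_pdf 0 1 x * \1_D x).
  by move=> mD; apply: measurable_funM => //; exact: measurable_normal_pdf.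
have N0 (D : set R) x : 0 <= normal_pdf 0 1 x * \1_D x.
  by rewrite mulr_ge0// normal_pdf_ge0.
rewrite fubini_tonelli1//=; first last.
- by move=> z; rewrite lee_fin mulr_ge0.
- by apply/measurable_EFinP/measurable_funM; apply: (measurableT_comp (mN _ _)).
rewrite !normal_prob_ge0E.
have mEN (D : set R) : measurable D ->
    measurable_fun [set: mR] (fun x : mR => (normal_pdf 0 1 x * \1_D x)%:E).
  by move=> /mN; exact: measurableT_comp.
rewrite -ge0_integralZr//; first last.
- by apply: integral_ge0 => x _; rewrite lee_fin.
- by move=> x _; rewrite lee_fin.
- exact: mEN.
apply: eq_integral => x _; rewrite /fubini_F/=.
under eq_integral do rewrite EFinM.
rewrite ge0_integralZl ?lee_fin//; first exact: mEN.
by move=> y _; rewrite lee_fin.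
Qed.

(** The joint density depends on the point only through the squared distance to the origin, which a
    reflection preserves, as it preserves planar Lebesgue measure. *)
Lemma normal_prob2_reflection (c s : R) (C : set (mR * mR)) :
  c ^+ 2 + s ^+ 2 = 1 -> 0 <= s -> measurable C ->
  (N01 \x N01)%E ((fun z => (c * z.1 + s * z.2, s * z.1 - c * z.2)) @^-1` C) =
  (N01 \x N01)%E C.
Proof.
move=> cs s0 mC; pose r (z : mR * mR) := (c * z.1 + s * z.2, s * z.1 - c * z.2).
have mr : measurable_fun [set: mR * mR] r.
  apply: measurable_fun_pair.
    by apply: measurable_funD; exact: measurable_funM.
  by apply: measurable_funB; exact: measurable_funM.
rewrite !normal_prob2E//; last by rewrite -[X in measurable X]setTI; exact: mr.
rewrite integral_mkcond [RHS]integral_mkcond.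
rewrite -[RHS](ge0_integral_leb2_reflection cs s0); first last.
- by move=> z; rewrite patchE; case: ifP => // _; rewrite lee_fin.
- apply/(measurable_restrictT _ _).1 => //.
  exact/measurable_funTS/measurable_EFinP.
apply: eq_integral => z _; rewrite !patchE.
rewrite [z \in _](_ : _ = (r z \in C))//.
case: ifP => // _; congr EFin.
rewrite /dens !normal_pdf01 /= mulrACA [RHS]mulrACA -!expRD.
congr (_ * expR _).
rewrite -!mulrDl -!opprD; congr (- _ / _).
rewrite [RHS](_ : _ = (c ^+ 2 + s ^+ 2) * (z.1 ^+ 2 + z.2 ^+ 2)); last by ring.
by rewrite cs mul1r.
Qed.

End planar_gaussian.

(** * Families of independent standard normal variables *)

(** A named copy of the function type, so that it can carry the sigma-algebra generated by the
    boxes. *)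
Definition coordinate_space (R : realType) (I : finType) : Type := I -> R.

Section coordinate_space_sigma_algebra.
Variables (R : realType) (I : finType).

HB.instance Definition _ := gen_eqMixin (coordinate_space R I).
HB.instance Definition _ := gen_choiceMixin (coordinate_space R I).
HB.instance Definition _ := isPointed.Build (coordinate_space R I) (fun=> 0).

Definition boxes : set (set (coordinate_space R I)) :=
  [set C | exists2 B : I -> set R, (forall i, measurable (B i)) &
     C = [set z | forall i, B i (z i)]].

HB.instance Definition _ :=
  Measurable.copy (coordinate_space R I) (g_sigma_algebraType boxes).

(** The boxes form a pi-system, so their masses determine a finite measure on the coordinate
    space. *)
Lemma setI_closed_boxes : setI_closed boxes.
Proof.
move=> _ _ [B mB ->] [C mC ->]; exists (fun i => B i `&` C i).
  by move=> i; exact: measurableI.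
by apply/seteqP; split=> z /=; [move=> [Bz Cz] i|move=> BC; split=> i; case: (BC i)].
Qed.

Lemma boxes_setT : boxes setT.
Proof. by exists (fun=> setT) => //; apply/seteqP; split. Qed.

Lemma measurable_coord (i : I) :
  measurable_fun setT (fun z : coordinate_space R I => z i).
Proof.
move=> _ B mB; rewrite setTI; apply: sub_sigma_algebra.
exists (fun j => if j == i then B else setT); first by move=> j; case: ifP.
apply/seteqP; split => z /=.
  by move=> Bzi j; case: ifP => // /eqP ->.
by move=> /(_ i); rewrite eqxx.
Qed.

Context {d : measure_display} {T : measurableType d}.

Lemma measurable_box (Z : I -> T -> R) (B : I -> set R) :
  (forall i, measurable_fun [set: T] (Z i)) -> (forall i, measurable (B i)) ->
  measurable [set w | forall i, B i (Z i w)].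
Proof.
move=> mZ mB.
rewrite (_ : mkset _ = \bigcap_(i in [set: I]) (Z i @^-1` B i)); last first.
  by apply/seteqP; split => w H i; [move=> _; exact: H|exact: (H i)].
apply: fin_bigcap_measurable => [|i _]; first exact: finite_finset.
by rewrite -[X in measurable X]setTI; exact: mZ.
Qed.

Lemma measurable_to_coordinates (Z : I -> T -> R) :
  (forall i, measurable_fun [set: T] (Z i)) ->
  measurable_fun [set: T] ((fun w i => Z i w) : T -> coordinate_space R I).
Proof.
move=> mZ; apply: (measurability boxes) => // _ [_ [B mB ->] <-].
by rewrite setTI; exact: measurable_box.
Qed.

End coordinate_space_sigma_algebra.

Definition iid_normal {R : realType} {d : measure_display}
    {T : measurableType d} (P : probability T R) (I : finType)
    (Z : I -> T -> R) : Prop :=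
  (forall i, has_law P (Z i) (normal_prob 0 1)) /\ mutually_independent P Z.

Section iid_normal_theory.
Context {R : realType} {d : measure_display} {T : measurableType d}.
Variable P : probability T R.
Local Notation N01 := (normal_prob (0 : R) 1).

Lemma iid_normal_measurable (I : finType) (Z : I -> T -> R) :
  iid_normal P Z -> forall i, measurable_fun [set: T] (Z i).
Proof. by move=> [ZN _] i; case: (ZN i). Qed.

Lemma normal_prob_setT : N01 [set: R] = 1%E.
Proof. exact: probability_setT. Qed.

Lemma iid_normal_box (I : finType) (Z : I -> T -> R) (B : I -> set R) :
  iid_normal P Z -> (forall i, measurable (B i)) ->
  P [set w | forall i, B i (Z i w)] = (\prod_i N01 (B i))%E.
Proof.
move=> [ZN Zi] mB.
rewrite (_ : mkset _ = \bigcap_(i in [set: I]) (Z i @^-1` B i)); last first.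
  by apply/seteqP; split => w H i; [move=> _; exact: H|exact: (H i)].
by rewrite Zi//; apply: eq_bigr => i _; case: (ZN i) => _ ->.
Qed.

(** Boxes with every side but one equal to the whole line give the marginal laws; the product rule
    then follows from the general boxes. *)
Lemma iid_normal_from_boxes (I : finType) (Z : I -> T -> R) :
  (forall i, measurable_fun [set: T] (Z i)) ->
  (forall B : I -> set R, (forall i, measurable (B i)) ->
    P [set w | forall i, B i (Z i w)] = (\prod_i N01 (B i))%E) ->
  iid_normal P Z.
Proof.
move=> mZ ZB.
have ZN i : has_law P (Z i) N01.
  split=> // B mB; pose C j := if j == i then B else setT.
  have mC j : measurable (C j) by rewrite /C; case: ifP.
  have := ZB _ mC; rewrite (bigD1 i)//= {2}/C eqxx big1 ?mule1; last first.
    by move=> j /negPf ji; rewrite /C ji normal_prob_setT.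
  move=> <-; congr (P _); apply/seteqP; split => w /=.
    by move=> Bw j; rewrite /C; case: ifP => // /eqP ->.
  by move=> /(_ i); rewrite /C eqxx.
split=> // B mB.
rewrite (_ : \bigcap_(i in _) _ = [set w | forall i, B i (Z i w)]); last first.
  by apply/seteqP; split => w H i; [exact: (H i)|move=> _; exact: H].
by rewrite ZB//; apply: eq_bigr => i _; case: (ZN i) => _ ->.
Qed.

Lemma iid_normal_sub (I J : finType) (h : J -> I) (Z : I -> T -> R) :
  injective h -> iid_normal P Z -> iid_normal P (fun j => Z (h j)).
Proof.
move=> hI ZI; apply: iid_normal_from_boxes => [j|B mB].
  exact: (iid_normal_measurable ZI).
(* Sides outside the image of [h] are the whole line and contribute a factor 1. *)
pose C i := if [pick j | h j == i] is Some j then B j else setT.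
have Ch j : C (h j) = B j.
  by rewrite /C; case: pickP => [j' /eqP/hI ->//|/(_ j)]; rewrite eqxx.
have mC i : measurable (C i) by rewrite /C; case: pickP.
have := iid_normal_box ZI mC.
rewrite (bigID (fun i => i \in h @: predT))/=.
rewrite [X in (_ * X)%E]big1 ?mule1; last first.
  move=> i /imsetP hi; rewrite /C; case: pickP => [j /eqP ij|_].
    by case: hi; exists j; rewrite ?inE ?ij.
  exact: normal_prob_setT.
rewrite big_imset/=; last by move=> ? ? _ _ /hI.
under eq_bigr do rewrite Ch.
rewrite (eq_bigl xpredT); last by move=> j; rewrite inE.
move=> <-; congr (P _); apply/seteqP; split => w /=.
  by move=> Bw i; rewrite /C; case: pickP => // j /eqP <-.
by move=> Cw j; rewrite -Ch.
Qed.

End iid_normal_theory.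

(** Both image measures agree on the pi-system of boxes. Since the two families may live on
    different spaces, a question about the joint law can be moved to a more convenient space. *)
Lemma iid_normal_law (R : realType) (I : finType)
    (d1 d2 : measure_display) (T1 : measurableType d1) (T2 : measurableType d2)
    (P1 : probability T1 R) (P2 : probability T2 R)
    (Z1 : I -> T1 -> R) (Z2 : I -> T2 -> R) :
  iid_normal P1 Z1 -> iid_normal P2 Z2 ->
  forall C : set (coordinate_space R I), measurable C ->
    P1 ((fun w i => Z1 i w) @^-1` C) = P2 ((fun w i => Z2 i w) @^-1` C).
Proof.
move=> ZI1 ZI2 C mC.
have m1 := measurable_to_coordinates (iid_normal_measurable ZI1).
have m2 := measurable_to_coordinates (iid_normal_measurable ZI2).
pose F1 : {mfun T1 >-> coordinate_space R I} :=
  HB.pack (_ : T1 -> coordinate_space R I) (isMeasurableFun.Build _ _ _ _ _ m1).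
pose F2 : {mfun T2 >-> coordinate_space R I} :=
  HB.pack (_ : T2 -> coordinate_space R I) (isMeasurableFun.Build _ _ _ _ _ m2).
apply: (measure_unique (@boxes R I) (fun=> setT) _ _ _ _
  (distribution P1 F1) (distribution P2 F2)) => //.
- exact: setI_closed_boxes.
- by move=> _; exact: boxes_setT.
- by rewrite bigcup_const.
- move=> _ [B mB ->].
  transitivity (\prod_i normal_prob (0 : R) 1 (B i))%E.
    exact: iid_normal_box ZI1 mB.
  exact/esym/(iid_normal_box ZI2 mB).
- by move=> _; rewrite (le_lt_trans (probability_le1 _ _))// ltry.
Qed.

Section block_independence.
Context {R : realType} (I J : finType).
Context {d1 d2 : measure_display} {T1 : measurableType d1} {T2 : measurableType d2}.
Variables (P1 : probability T1 R) (P2 : probability T2 R).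

(** A box over [I + J] pulls back to a rectangle of the product space. *)
Lemma iid_normal_pair (Z1 : I -> T1 -> R) (Z2 : J -> T2 -> R) :
  iid_normal P1 Z1 -> iid_normal P2 Z2 ->
  iid_normal (P1 \x P2)%E (fun (k : I + J) (z : T1 * T2) =>
    match k with inl i => Z1 i z.1 | inr j => Z2 j z.2 end).
Proof.
move=> ZI1 ZI2; have m1 := iid_normal_measurable ZI1.
have m2 := iid_normal_measurable ZI2.
apply: iid_normal_from_boxes => [[i|j]|B mB].
- by apply: (measurableT_comp (m1 i)).
- by apply: (measurableT_comp (m2 j)).
rewrite big_sumType/= -(iid_normal_box ZI1)// -(iid_normal_box ZI2)//.
have mB1 := measurable_box m1 (fun i => mB (inl i)).
have mB2 := measurable_box m2 (fun j => mB (inr j)).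
rewrite -(product_measure1E _ _ mB1 mB2).
congr (_ _); apply/seteqP; split => -[w1 w2] /=.
  by move=> H; split=> i; [exact: (H (inl i))|exact: (H (inr i))].
by move=> [H1 H2] [i|j].
Qed.

End block_independence.

Section rotations.
Context {R : realType} {d : measure_display} {T : measurableType d}.
Variable P : probability T R.
Local Notation N01 := (normal_prob (0 : R) 1).

(* Drawing the two blocks from independent copies of the probability space
   does not change the joint law of the family. *)
Lemma iid_normal_blocks (I J : finType) (Z : I + J -> T -> R)
    (C : set (coordinate_space R I)) (D : set (coordinate_space R J)) :
  iid_normal P Z -> measurable C -> measurable D ->
  P ((fun w i => Z (inl i) w) @^-1` C `&` (fun w j => Z (inr j) w) @^-1` D) =
  (P ((fun w i => Z (inl i) w) @^-1` C) *
   P ((fun w j => Z (inr j) w) @^-1` D))%E.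
Proof.
move=> ZI mC mD.
have ZIl : iid_normal P (fun i => Z (inl i)).
  by apply: (iid_normal_sub (h := inl)) => // ? ? [].
have ZIr : iid_normal P (fun j => Z (inr j)).
  by apply: (iid_normal_sub (h := inr)) => // ? ? [].
have ZZ := iid_normal_pair ZIl ZIr.
have ml := measurable_to_coordinates (iid_normal_measurable ZIl).
have mr := measurable_to_coordinates (iid_normal_measurable ZIr).
pose CD : set (coordinate_space R (I + J)%type) :=
  [set z | C (fun i => z (inl i)) /\ D (fun j => z (inr j))].
have mCD : measurable CD.
  have -> : CD = (fun z i => z (inl i)) @^-1` C `&` (fun z j => z (inr j)) @^-1` D by [].
  apply: measurableI; rewrite -[X in measurable X]setTI.
    by apply: measurable_to_coordinates => // i; exact: measurable_coord.
  by apply: measurable_to_coordinates => // i; exact: measurable_coord.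
rewrite [LHS](iid_normal_law ZI ZZ mCD) -product_measure1E//.
- by rewrite -[X in measurable X]setTI; exact: ml.
- by rewrite -[X in measurable X]setTI; exact: mr.
Qed.

(* The law of the family is unchanged if the coordinates i and j are drawn from
   a separate factor N(0,1) x N(0,1), on which the planar invariance applies. *)
Lemma iid_normal_reflection (I : finType) (i j : I) (c s : R) (Z : I -> T -> R) :
  i != j -> c ^+ 2 + s ^+ 2 = 1 -> 0 <= s -> iid_normal P Z ->
  iid_normal P (fun k w => if k == i then c * Z i w + s * Z j w
     else if k == j then s * Z i w - c * Z j w else Z k w).
Proof.
move=> ij cs s0 ZI; have mZ := iid_normal_measurable ZI.
have ji : (j == i) = false by rewrite eq_sym (negPf ij).
pose refl (I' : finType) (a b : I') (z : I' -> R) k :=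
  if k == a then c * z a + s * z b else if k == b then s * z a - c * z b else z k.
pose rest (B : I -> set R) :=
  [set w | forall k, k != i -> k != j -> B k (Z k w)].
have restE B : (forall k, measurable (B k)) -> measurable (rest B) /\
    P (rest B) = (\prod_(k | (k != i) && (k != j)) N01 (B k))%E.
  move=> mB; pose C k := if (k != i) && (k != j) then B k else setT.
  have mC k : measurable (C k) by rewrite /C; case: ifP.
  have -> : rest B = [set w | forall k, C k (Z k w)].
    apply/seteqP; split => w /= H k.
      by rewrite /C; case: ifP => // /andP[]; exact: H.
    by move=> ki kj; have := H k; rewrite /C ki kj.
  split; first exact: measurable_box.
  rewrite (iid_normal_box ZI)// [RHS]big_mkcond; apply: eq_bigr => k _.
  by rewrite /C; case: ifP => // _; exact: normal_prob_setT.
pose Y (k : I) (z : (measurableTypeR R * measurableTypeR R) * T) :=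
  if k == i then z.1.1 else if k == j then z.1.2 else Z k z.2.
have mBR (B : I -> set R) k : measurable (B k) ->
    measurable (B k : set (measurableTypeR R)) by exact.
have mBij (B : I -> set R) : (forall k, measurable (B k)) ->
    measurable (B i `*` B j : set (measurableTypeR R * measurableTypeR R)).
  by move=> mB; apply: measurableX; exact: mBR.
have prodB (B : I -> set R) : (forall k, measurable (B k)) -> (\prod_k N01 (B k) =
    (N01 \x N01) (B i `*` B j) * \prod_(k | (k != i) && (k != j)) N01 (B k))%E.
  move=> mB; rewrite (bigD1 i)//= (bigD1 j) ?ji//= muleA.
  by rewrite (product_measure1E N01 N01 (mBR _ _ (mB i)) (mBR _ _ (mB j))).
have YI : iid_normal ((N01 \x N01) \x P)%E Y.
  apply: iid_normal_from_boxes => [k|B mB].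
    rewrite /Y; case: (k == i); [|case: (k == j)].
    - by apply: (measurableT_comp (f := @fst (measurableTypeR R) (measurableTypeR R))).
    - by apply: (measurableT_comp (f := @snd (measurableTypeR R) (measurableTypeR R))).
    - by apply: (measurableT_comp (mZ k)).
  have [mr rE] := restE B mB.
  rewrite prodB// -rE -(product_measure1E _ _ (mBij B mB) mr).
  congr (_ _); apply/seteqP; split => -[[x y] w] /=.
    move=> H; split; first split.
    - by have := H i; rewrite /Y eqxx.
    - by have := H j; rewrite /Y ji eqxx.
    - by move=> k ki kj; have := H k; rewrite /Y (negPf ki) (negPf kj).
  move=> [[Bx By] Br] k; rewrite /Y; case: (eqVneq k i) => [->//|ki].
  by case: (eqVneq k j) => [->//|kj]; exact: Br.
have mrefl k (d' : measure_display) (T' : measurableType d') (V : I -> T' -> R) :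
    (forall k, measurable_fun setT (V k)) ->
    measurable_fun setT (fun w => refl I i j (V^~ w) k).
  move=> mV; rewrite /refl; case: (k == i); [|case: (k == j)] => //.
    by apply: measurable_funD; exact: measurable_funM.
  by apply: measurable_funB; exact: measurable_funM.
apply: iid_normal_from_boxes => [k|B mB]; first exact: (mrefl k _ _ Z).
pose Om := coordinate_space R I.
have mC : measurable ([set z | forall k, B k (refl I i j z k)] : set Om).
  apply: (measurable_box (Z := fun k (z : Om) => refl I i j z k)) => // k.
  by apply: (mrefl k _ _ (fun k (z : Om) => z k)); exact: measurable_coord.
have [mr rE] := restE B mB.
(* For [Y] the event is the product of the reflected preimage of [B i * B j] in the plane and of
   [rest B], so only the planar factor has to be compared. *)
rewrite [LHS](iid_normal_law ZI YI mC) prodB//.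
rewrite -(normal_prob2_reflection cs s0)//; last exact: mBij.
have mr2 : measurable_fun setT (fun z : measurableTypeR R * measurableTypeR R =>
    (c * z.1 + s * z.2, s * z.1 - c * z.2)).
  apply: measurable_fun_pair.
    by apply: measurable_funD; exact: measurable_funM.
  by apply: measurable_funB; exact: measurable_funM.
have mrB := mr2 measurableT _ (mBij B mB); rewrite setTI in mrB.
rewrite -rE -(product_measure1E _ _ mrB mr).
congr (_ _); apply/seteqP; split => -[[x y] w] /=.
  move=> H; split; first split.
  - by have := H i; rewrite /refl /Y !eqxx ji.
  - by have := H j; rewrite /refl /Y ji !eqxx.
  - by move=> k ki kj; have := H k; rewrite /refl /Y (negPf ki) (negPf kj).
move=> [[Bx By] Br] k; rewrite /refl /Y !eqxx ji.
case: (eqVneq k i) => [->//|ki].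
by case: (eqVneq k j) => [->//|kj]; exact: Br.
Qed.

End rotations.

(** * Reduction of orthonormal families by plane reflections *)

Section plane_reflections.
Context {R : rcfType} {N : nat}.
Implicit Types (i j k l : 'I_N) (c s : R).

(** Reflections are preferred to rotations because, for [c ^+ 2 + s ^+ 2 = 1], the matrix is
    symmetric and its own inverse: undoing an elimination step is a step of the same kind. *)
Definition plane_reflection i j c s : 'M[R]_N :=
  \matrix_(k, l) if k == i then c * (l == i)%:R + s * (l == j)%:R
    else if k == j then s * (l == i)%:R - c * (l == j)%:R else (k == l)%:R.

Lemma sum_delta (m : nat) (f : 'I_m -> R) (i : 'I_m) :
  \sum_l (l == i)%:R * f l = f i.
Proof.
rewrite (bigD1 i)//= eqxx mul1r big1 ?addr0// => l /negPf ->.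
by rewrite mul0r.
Qed.

(** The right-hand side is the shape in which [iid_normal_reflection] transforms a family. *)
Lemma plane_reflection_sum i j c s (z : 'I_N -> R) k : i != j ->
  \sum_l plane_reflection i j c s k l * z l =
  if k == i then c * z i + s * z j else if k == j then s * z i - c * z j else z k.
Proof.
move=> ij; under eq_bigr do rewrite mxE.
case: ifP => _.
  under eq_bigr do rewrite mulrDl -!mulrA.
  by rewrite big_split/= -!mulr_sumr !sum_delta.
case: ifP => _.
  under eq_bigr do rewrite mulrBl -!mulrA.
  by rewrite big_split/= sumrN -!mulr_sumr !sum_delta.
by under eq_bigr do rewrite eq_sym; rewrite sum_delta.
Qed.

Lemma tr_plane_reflection i j c s : i != j ->
  (plane_reflection i j c s)^T = plane_reflection i j c s.
Proof.
move=> /negPf ij; have ji : (j == i) = false by rewrite eq_sym.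
apply/matrixP => k l; rewrite !mxE.
have [->|ki] := eqVneq k i; have [->|li] := eqVneq l i; rewrite ?eqxx ?ij//.
- by have [_|_] := eqVneq l j; rewrite ?mulr0 ?mulr1 ?subr0 ?addr0 ?add0r.
- have [_|_] := eqVneq k j; rewrite ?mulr0 ?mulr1 ?subr0 ?addr0 ?add0r//.
  by rewrite (negPf ki).
have [kj|kj] := eqVneq k j; have [lj|lj] := eqVneq l j; rewrite ?mulr0 ?subr0 //.
- by rewrite kj (negPf lj) ?mulr0 ?oppr0.
- by rewrite lj (negPf kj).
- by rewrite eq_sym.
Qed.

Lemma mulmx_plane_reflection (m : nat) (A : 'M[R]_(m, N)) i j c s r l : i != j ->
  (A *m plane_reflection i j c s) r l =
  if l == i then c * A r i + s * A r j else if l == j then s * A r i - c * A r j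
  else A r l.
Proof.
move=> ij; rewrite -(plane_reflection_sum c s (A r) l ij) mxE.
apply: eq_bigr => k _; rewrite mulrC -[in LHS]tr_plane_reflection//.
by rewrite [in LHS]mxE.
Qed.

Lemma plane_reflectionK (m : nat) (A : 'M[R]_(m, N)) i j c s : i != j ->
  c ^+ 2 + s ^+ 2 = 1 ->
  A *m plane_reflection i j c s *m plane_reflection i j c s = A.
Proof.
move=> ij cs; have ji : (j == i) = false by rewrite eq_sym (negPf ij).
apply/matrixP => r l; rewrite !mulmx_plane_reflection// !eqxx ji.
case: eqP => [->|_]; [|case: eqP => [->|//]].
  by rewrite -[RHS]mul1r -cs; ring.
by rewrite -[RHS]mul1r -cs; ring.
Qed.

Lemma mulmx_plane_reflection_tr i j c s : i != j -> c ^+ 2 + s ^+ 2 = 1 ->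
  plane_reflection i j c s *m (plane_reflection i j c s)^T = 1%:M.
Proof.
move=> ij cs; rewrite tr_plane_reflection//.
by have := plane_reflectionK 1%:M ij cs; rewrite mul1mx.
Qed.

(* Givens elimination: the rows are turned one after the other into unit
   vectors, each reflection killing one entry of the current row. *)
Lemma orthonormal_rows_ind (G : 'M[R]_N -> Prop) : (1 < N)%N -> G 1%:M ->
  (forall Q i j c s, i != j -> c ^+ 2 + s ^+ 2 = 1 -> 0 <= s ->
    G Q -> G (Q *m plane_reflection i j c s)) ->
  forall (k : nat) (A : 'M[R]_(k, N)), A *m A^T = 1%:M ->
  exists2 Q, G Q & A = pid_mx k *m Q.
Proof.
move=> N1 G1 GM k A AA.
have kN : (k <= N)%N.
  apply: leq_trans (rank_leq_col A).
  by apply: (@mulmx1_min_rank _ _ _ _ A 1%:M A^T); rewrite mul1mx.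
(* The reflection being an involution, a factorisation of the reflected matrix yields one of
   [A']. *)
have step (A' : 'M[R]_(k, N)) i j c s : i != j -> c ^+ 2 + s ^+ 2 = 1 -> 0 <= s ->
    (exists2 Q, G Q & A' *m plane_reflection i j c s = pid_mx k *m Q) ->
    exists2 Q, G Q & A' = pid_mx k *m Q.
  move=> ij cs s0 [Q GQ AQ]; exists (Q *m plane_reflection i j c s).
    exact: GM.
  by rewrite mulmxA -AQ plane_reflectionK.
have orth (A' : 'M[R]_(k, N)) i j c s : i != j -> c ^+ 2 + s ^+ 2 = 1 ->
    A' *m A'^T = 1%:M ->
    (A' *m plane_reflection i j c s) *m (A' *m plane_reflection i j c s)^T = 1%:M.
  move=> ij cs AA'; rewrite trmx_mul mulmxA -[X in X *m _]mulmxA.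
  by rewrite mulmx_plane_reflection_tr// mulmx1.
have orthE (A' : 'M[R]_(k, N)) r r' : A' *m A'^T = 1%:M ->
    \sum_l A' r l * A' r' l = (r == r')%:R.
  move=> /matrixP/(_ r r'); rewrite !mxE => <-.
  by apply: eq_bigr => l _; rewrite mxE.
(* Outer induction on the number [m] of rows left to treat: the first [k - m] rows are already unit
   vectors. *)
suff H m : forall A : 'M[R]_(k, N), A *m A^T = 1%:M -> (m <= k)%N ->
    (forall (r : 'I_k) l, (r < k - m)%N -> A r l = (r == l :> nat)%:R) ->
    exists2 Q, G Q & A = pid_mx k *m Q.
  by apply: (H k) => // r l; rewrite subnn.
elim: m => {A AA} [|m IHm] A AA mk Ae.
  exists 1%:M => //; rewrite mulmx1; apply/matrixP => r l.
  by rewrite Ae ?subn0// mxE ltn_ord andbT.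
pose j := (k - m.+1)%N.
have jk : (j < k)%N by rewrite /j; lia.
pose jr := Ordinal jk; pose jc : 'I_N := Ordinal (leq_trans jk kN).
(* Inner induction on the number of nonzero entries of row [j] off the diagonal. *)
have cnt : forall t (A : 'M[R]_(k, N)), A *m A^T = 1%:M ->
    (forall (r : 'I_k) l, (r < j)%N -> A r l = (r == l :> nat)%:R) ->
    (#|[pred i | (i != jc) && (A jr i != 0%R)]| <= t)%N ->
    exists2 Q, G Q & A = pid_mx k *m Q.
  elim=> {A AA Ae} [|n IHn] A AA Ae An; last first.
    case: (pickP [pred i | (i != jc) && (A jr i != 0)]) => [i /=|A0]; last first.
      by apply: IHn => //; rewrite eq_card0.
    move=> /andP[ij Ai].
    (* Row [j] is orthogonal to the earlier rows, which are unit vectors, so its entries in columns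
       before [j] vanish. A reflection in columns [j] and [i > j] therefore leaves the finished rows
       alone. *)
    have ji : (j < i)%N.
      rewrite ltn_neqAle; apply/andP; split.
        by apply: contra ij => /eqP ij; apply/eqP/val_inj; rewrite /= ij.
      rewrite leqNgt; apply/negP => ij'; have ik : (i < k)%N by lia.
      have := orthE A (Ordinal ik) jr AA.
      under eq_bigr do rewrite Ae//=.
      rewrite (bigD1 i)//= eqxx mul1r big1 => [|l li]; last first.
        rewrite (_ : (i == l :> nat) = false) ?mul0r//.
        by apply/negbTE; apply: contra li => /eqP li; apply/eqP/val_inj.
      rewrite addr0 => Ai0; move: Ai; rewrite Ai0.
      have -> : (Ordinal ik == jr) = false.
        by apply/negbTE/eqP => /(congr1 val)/=; lia.
      by rewrite eqxx.
    pose h := Num.sqrt (A jr jc ^+ 2 + A jr i ^+ 2).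
    have h2 : h ^+ 2 = A jr jc ^+ 2 + A jr i ^+ 2.
      by rewrite sqr_sqrtr// addr_ge0// sqr_ge0.
    have h0 : 0 < h.
      by rewrite sqrtr_gt0 ltr_wpDl ?sqr_ge0// exprn_even_gt0.
    (* The sign makes the coefficient [s = A jr i / rho] nonnegative, as required of the admissible
       reflections. *)
    pose rho := Num.sg (A jr i) * h.
    have rho2 : rho ^+ 2 = h ^+ 2.
      by rewrite /rho exprMn sqr_sg Ai mul1r.
    have rho0 : rho != 0 by rewrite mulf_neq0 ?sgr_eq0// gt_eqF.
    have cs : (A jr jc / rho) ^+ 2 + (A jr i / rho) ^+ 2 = 1.
      by rewrite !expr_div_n -mulrDl -h2 rho2 divff// expf_neq0// gt_eqF.
    have s0 : 0 <= A jr i / rho.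
      rewrite /rho {1}[A jr i]numEsg -mulf_div divff ?sgr_eq0// mul1r.
      by rewrite divr_ge0// ltW.
    have jci : jc != i by rewrite eq_sym.
    apply: (step _ _ _ _ _ jci cs s0); apply: IHn; first exact: orth.
      move=> r l rj; rewrite mulmx_plane_reflection//.
      move: (A jr jc / rho) (A jr i / rho) => u v; rewrite !Ae//.
      have -> : (r == jc :> nat) = false by rewrite /=; lia.
      have -> : (r == i :> nat) = false by lia.
      rewrite !mulr0 addr0 subr0.
      case: (eqVneq l jc) => [->/=|_]; first by rewrite (_ : _ == _ = false)//; lia.
      by case: (eqVneq l i) => [->|//]; rewrite (_ : _ == _ = false)//; lia.
    rewrite -ltnS; apply: leq_trans An; apply: proper_card; apply/properP; split.
      apply/fintype.subsetP => l; rewrite !inE => /andP[lj]; rewrite lj.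
      rewrite mulmx_plane_reflection// (negPf lj).
      by case: (eqVneq l i) => [->//|].
    exists i; rewrite !inE ?ij//=.
    rewrite mulmx_plane_reflection// (negPf ij) eqxx negbK; apply/eqP.
    by ring.
  have A0 l : l != jc -> A jr l = 0.
    move=> lj; apply/eqP; move: An; rewrite leqn0 => /eqP/card0_eq/(_ l).
    by rewrite !inE lj /= => /negbFE.
  have Ajj : A jr jc ^+ 2 = 1.
    have E := orthE A jr jr AA; rewrite eqxx in E; apply: etrans E.
    by rewrite (bigD1 jc)//= big1 ?addr0 ?expr2// => l /A0 ->; rewrite mul0r.
  have last (A' : 'M[R]_(k, N)) : A' *m A'^T = 1%:M ->
      (forall (r : 'I_k) l, (r < j)%N -> A' r l = (r == l :> nat)%:R) ->
      A' jr jc = 1 -> (forall l, l != jc -> A' jr l = 0) ->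
      exists2 Q, G Q & A' = pid_mx k *m Q.
    move=> AA' A'e A'1 A'0; apply: IHm => // [|r l rj]; first exact: ltnW.
    have [rj'|rj'] := ltnP r j; first exact: A'e.
    have -> : r = jr by apply: val_inj => /=; rewrite /j in rj' *; lia.
    case: (eqVneq l jc) => [->|lj]; first by rewrite A'1 eqxx.
    rewrite A'0// (_ : _ == _ = false)//.
    by apply/negbTE; apply: contra lj => /eqP lj; apply/eqP/val_inj.
  move/eqP: Ajj; rewrite sqrf_eq1 => /orP[/eqP A1|/eqP A1]; first exact: last.
  (* Row [j] is now the negative of a unit vector. The reflection with [c = -1] and [s = 0] merely
     negates column [jc]; it needs a second index, hence [1 < N]. *)
  have [i ij] : exists i : 'I_N, jc != i.
    pose i0 : 'I_N := Ordinal (ltnW N1); pose i1 : 'I_N := Ordinal N1.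
    by case: (eqVneq jc i0) => [->|]; [exists i1|exists i0].
  have cs : (-1) ^+ 2 + 0 ^+ 2 = 1 :> R by rewrite sqrrN expr1n expr0n addr0.
  apply: (step _ _ _ _ _ ij cs (lexx _)); apply: last; first exact: orth.
  - move=> r l rj; rewrite mulmx_plane_reflection// !Ae//.
    rewrite !mul0r addr0 add0r mulN1r mulN1r opprK.
    case: (eqVneq l jc) => [->/=|_]; last by case: eqP => // ->.
    by rewrite (_ : _ == _ = false) ?oppr0//; lia.
  - by rewrite mulmx_plane_reflection// eqxx A1 mul0r addr0 mulN1r opprK.
  - move=> l lj; rewrite mulmx_plane_reflection// (negPf lj).
    case: (eqVneq l i) => [_|_]; last exact: A0.
    by rewrite (A0 i) 1?eq_sym// mulr0 mul0r subr0.
exact: (cnt _ A AA Ae (leqnn _)).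
Qed.

End plane_reflections.

(** * Orthonormal combinations of independent standard normal variables *)

Section rotation_invariance.
Context {R : realType} {d : measure_display} {T : measurableType d}.
Variable P : probability T R.

Lemma iid_normal_eq (I : finType) (Z Y : I -> T -> R) :
  (forall i w, Z i w = Y i w) -> iid_normal P Z -> iid_normal P Y.
Proof.
by move=> ZY; rewrite (_ : Z = Y)//; apply/funext => i; apply/funext => w.
Qed.

(** The coefficient matrix consists of the first rows of a product of plane reflections. Each
    reflection preserves the property, and keeping some rows is passing to a subfamily. *)
Lemma iid_normal_orthonormal (I K : finType) (a : K -> I -> R)
    (Z : I -> T -> R) : (1 < #|I|)%N ->
  (forall k l, \sum_i a k i * a l i = (k == l)%:R) -> iid_normal P Z ->
  iid_normal P (fun k w => \sum_i a k i * Z i w).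
Proof.
move=> I1 ao ZI.
pose A : 'M[R]_(#|K|, #|I|) := \matrix_(k, i) a (enum_val k) (enum_val i).
pose Y (l : 'I_#|I|) w := Z (enum_val l) w.
have YI : iid_normal P Y by apply: iid_normal_sub ZI; exact: enum_val_inj.
have AA : A *m A^T = 1%:M.
  apply/matrixP => k l; rewrite !mxE -(inj_eq enum_val_inj) -ao.
  rewrite [RHS](big_enum_val)/=; apply: eq_bigr => i _; by rewrite !mxE.
(* All families are quantified over because in [Q *m plane_reflection i j c s] the reflection acts
   first, and [Q] is then applied to the reflected family. *)
pose G (Q : 'M[R]_#|I|) := forall Y : 'I_#|I| -> T -> R, iid_normal P Y ->
  iid_normal P (fun k w => \sum_l Q k l * Y l w).
have [Q GQ AQ] : exists2 Q, G Q & A = pid_mx #|K| *m Q.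
  apply: orthonormal_rows_ind => // [|Q i j c s ij cs s0 GQ] Y' Y'I.
    apply: iid_normal_eq Y'I => k w; rewrite (bigD1 k)//= mxE eqxx mul1r.
    rewrite big1 ?addr0// => l /negPf lk.
    by rewrite mxE eq_sym lk mul0r.
  apply: iid_normal_eq (GQ _ (iid_normal_reflection ij cs s0 Y'I)) => k w.
  under eq_bigr do rewrite -(plane_reflection_sum c s (Y'^~ w) _ ij) mulr_sumr.
  rewrite exchange_big/=; apply: eq_bigr => l _; rewrite mxE mulr_suml.
  by apply: eq_bigr => m _; rewrite mulrA.
have KI : (#|K| <= #|I|)%N.
  apply: leq_trans (rank_leq_col A).
  by apply: (@mulmx1_min_rank _ _ _ _ A 1%:M A^T); rewrite mul1mx.
have WI := iid_normal_sub (h := fun k : K => widen_ord KI (enum_rank k)) _ (GQ _ YI).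
apply: iid_normal_eq (WI _) => [k w|k l]; last first.
  by move=> /(congr1 val) /= kl; apply/enum_rank_inj/val_inj.
rewrite [RHS](big_enum_val)/=; apply: eq_bigr => i _.
rewrite /Y; congr (_ * _).
transitivity (A (enum_rank k) i); last by rewrite mxE enum_rankK.
rewrite AQ mxE (bigD1 (widen_ord KI (enum_rank k)))//= mxE eqxx ltn_ord mul1r.
rewrite big1 ?addr0// => l lk; rewrite mxE.
rewrite (_ : (_ == _ :> nat) = false) ?mul0r//.
by apply/negbTE; apply: contra lk => /eqP lk; apply/eqP/val_inj.
Qed.

End rotation_invariance.

(** [A^T] forms the first [d] rows of an orthogonal [Q], and [B^T] is the remaining ones. The blocks
    of [Q *m Q^T = 1] give the first two identities, and [Q^T *m Q = 1] gives the third. *)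
Lemma orthonormal_completion (R : rcfType) (d q : nat) (A : 'M[R]_(d + q, d)) :
  (1 < d + q)%N -> A^T *m A = 1%:M ->
  exists B : 'M[R]_(d + q, q),
    [/\ A^T *m B = 0, B^T *m B = 1%:M & A *m A^T + B *m B^T = 1%:M].
Proof.
move=> dq AA.
pose G (Q : 'M[R]_(d + q)) := Q *m Q^T = 1%:M.
have [Q QQ AQ] : exists2 Q, G Q & A^T = pid_mx d *m Q.
  apply: orthonormal_rows_ind => //; rewrite ?trmxK// /G.
    by rewrite trmx1 mulmx1.
  move=> Q i j c s ij cs s0 QQ; rewrite trmx_mul mulmxA -[X in X *m _]mulmxA.
  by rewrite mulmx_plane_reflection_tr// mulmx1.
have QE : Q = col_mx A^T (dsubmx Q).
  rewrite -{1}[Q]vsubmxK; congr col_mx; rewrite AQ -{2}[Q]vsubmxK.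
  by rewrite pid_mx_row mul_row_col mul1mx mul0mx addr0.
move: QQ (QQ); rewrite /G => /mulmx1C; rewrite QE tr_col_mx.
rewrite mul_row_col mul_col_row !trmxK => AB.
rewrite [1%:M]scalar_mx_block => /eq_block_mx[_ AB0 _ BB].
by exists (dsubmx Q)^T; rewrite trmxK; split => //; rewrite AB -scalar_mx_block.
Qed.

(** [b] is the Householder reflection exchanging [u] with the unit vector at [k0]. The difference
    [v] of the two has squared norm [2 * (1 - u k0)], so [c] is 2 divided by that norm. *)
Lemma orthonormal_unit_vector (R : rcfType) (K : finType) (k0 : K) (u : K -> R) :
  \sum_k u k ^+ 2 = 1 ->
  exists b : K -> K -> R, [/\ forall k l, \sum_i b k i * b l i = (k == l)%:R,
    forall k l, b k l = b l k & forall k, b k0 k = u k].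
Proof.
move=> u1; pose v k := u k - (k == k0)%:R.
pose c := (1 - u k0)^-1.
have sumd (f : K -> R) k : \sum_i (k == i)%:R * f i = f k.
  rewrite (bigD1 k)//= eqxx mul1r big1 ?addr0// => l; rewrite eq_sym => /negPf ->.
  by rewrite mul0r.
have vv : \sum_i v i * v i = 2 * (1 - u k0).
  rewrite (eq_bigr (fun i => u i ^+ 2 - 2 * ((k0 == i)%:R * u i) +
      (k0 == i)%:R * (k0 == i)%:R)); last first.
    by move=> i _; rewrite /v [k0 == i]eq_sym; ring.
  rewrite big_split/= big_split/= sumrN -mulr_sumr !sumd u1 eqxx /=; ring.
(* In this degenerate case [v] vanishes, [u] is already the unit vector at [k0], and the identity
   serves. *)
have [u0|u0] := eqVneq (u k0) 1.
  exists (fun k i => (k == i)%:R); split => [k l|k l|k].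
  - by rewrite sumd eq_sym.
  - by rewrite eq_sym.
  have v0 : \sum_i v i ^+ 2 = 0.
    by under eq_bigr do rewrite expr2; rewrite vv u0 subrr mulr0.
  have := psumr_eq0P (fun i _ => sqr_ge0 (v i)) v0 (i := k) isT.
  by move=> /eqP; rewrite sqrf_eq0 subr_eq0 [k == k0]eq_sym => /eqP ->.
have c0 : c * (1 - u k0) = 1 by rewrite mulVf// subr_eq0 eq_sym.
exists (fun k i => (k == i)%:R - c * v k * v i); split => [k l|k l|k].
  rewrite (eq_bigr (fun i => (k == i)%:R * (l == i)%:R - c * v l * ((k == i)%:R * v i)
     - c * v k * ((l == i)%:R * v i) + c ^+ 2 * v k * v l * (v i * v i))); last first.
    by move=> i _; ring.
  rewrite !big_split/= !sumrN -!mulr_sumr !sumd vv [l == k]eq_sym.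
  rewrite -[RHS]addr0; rewrite -!addrA; congr (_ + _).
  have -> : c ^+ 2 * v k * v l * (2 * (1 - u k0)) =
    2 * c * v k * v l * (c * (1 - u k0)) by ring.
  by rewrite c0; ring.
  by rewrite [k == l]eq_sym mulrAC.
rewrite [v k0]/v eqxx (_ : c * (u k0 - 1%:R) = - (c * (1 - u k0))); last by ring.
by rewrite c0 /v eq_sym; ring.
Qed.

(** * Measurability and non-central F laws *)

Lemma measurable_preimage (d1 d2 : measure_display) (T1 : measurableType d1)
    (T2 : measurableType d2) (f : T1 -> T2) (B : set T2) :
  measurable_fun [set: T1] f -> measurable B -> measurable (f @^-1` B).
Proof. by move=> mf mB; rewrite -[X in measurable X]setTI; exact: mf. Qed.

Lemma measurable_shift (R : realType) (a : R) (B : set R) :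
  measurable B -> measurable ((fun x => x + a) @^-1` B).
Proof. by apply: measurable_preimage; exact: measurable_funD. Qed.

Section measurability.
Context {R : realType} {d : measure_display} {T : measurableType d}.

Lemma measurable_fun_inv (f : T -> R) :
  measurable_fun [set: T] f -> measurable_fun [set: T] (fun w => (f w)^-1).
Proof.
move=> mf.
(* The inverse becomes a product of measurable functions; at a zero of [f] the first factor
   vanishes, in agreement with the convention [0^-1 = 0]. *)
rewrite (_ : (fun w => _) = (fun w => f w * (`|f w| `^ (-1)) ^+ 2)).
  apply: measurable_funM => //; apply: measurable_funX.
  have mn := measurableT_comp (@normr_measurable R setT) mf.
  exact: (measurableT_comp (measurable_powR (-1)) mn).
apply/funext => w; rewrite powR_inv1// exprVn -normrX ger0_norm ?sqr_ge0//.
have [->|f0] := eqVneq (f w) 0; first by rewrite mul0r invr0.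
by field.
Qed.

Lemma measurable_sqrt : measurable_fun [set: R] (@Num.sqrt R).
Proof. by apply: continuous_measurable_fun; exact: sqrt_continuous. Qed.

Definition mx_measurable (m n : nat) (M : T -> 'M[R]_(m, n)) : Prop :=
  forall i j, measurable_fun [set: T] (fun w => M w i j).

Lemma mx_measurable_cst (m n : nat) (A : 'M[R]_(m, n)) :
  mx_measurable (fun=> A).
Proof. by move=> i j; exact: measurable_cst. Qed.

Lemma mx_measurable_add (m n : nat) (M N : T -> 'M[R]_(m, n)) :
  mx_measurable M -> mx_measurable N -> mx_measurable (fun w => M w + N w).
Proof.
move=> mM mN i j; under eq_fun do rewrite mxE.
by apply: measurable_funD; [exact: mM|exact: mN].
Qed.

Lemma mx_measurable_scale (m n : nat) (f : T -> R) (M : T -> 'M[R]_(m, n)) :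
  measurable_fun [set: T] f -> mx_measurable M ->
  mx_measurable (fun w => f w *: M w).
Proof.
move=> mf mM i j; under eq_fun do rewrite mxE.
by apply: measurable_funM; [exact: mf|exact: mM].
Qed.

Lemma mx_measurable_tr (m n : nat) (M : T -> 'M[R]_(m, n)) :
  mx_measurable M -> mx_measurable (fun w => (M w)^T).
Proof. by move=> mM i j; under eq_fun do rewrite mxE; exact: mM. Qed.

Lemma mx_measurable_mul (m n k : nat) (M : T -> 'M[R]_(m, n))
    (N : T -> 'M[R]_(n, k)) :
  mx_measurable M -> mx_measurable N -> mx_measurable (fun w => M w *m N w).
Proof.
move=> mM mN i j; under eq_fun do rewrite mxE.
by apply: measurable_sum => l; apply: measurable_funM; [exact: mM|exact: mN].
Qed.

Lemma mx_measurable_trace (m : nat) (M : T -> 'M[R]_m) :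
  mx_measurable M -> measurable_fun [set: T] (fun w => \tr (M w)).
Proof. by move=> mM; apply: measurable_sum => i; exact: mM. Qed.

Lemma mx_measurable_det (m : nat) (M : T -> 'M[R]_m) :
  mx_measurable M -> measurable_fun [set: T] (fun w => \det (M w)).
Proof.
move=> mM; apply: measurable_sum => s; apply: measurable_funM => //.
by apply: measurable_prod => i _; exact: mM.
Qed.

Lemma mx_measurable_adj (m : nat) (M : T -> 'M[R]_m) :
  mx_measurable M -> mx_measurable (fun w => \adj (M w)).
Proof.
move=> mM i j; under eq_fun do rewrite mxE.
apply: measurable_funM => //; apply: mx_measurable_det => k l.
by under eq_fun do rewrite !mxE; exact: mM.
Qed.

End measurability.

Section noncentral_F_law.
Context {R : realType} {d : measure_display} {T : measurableType d}.
Variable P : probability T R.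

Lemma noncentral_chi2_sum (K : finType) (Z : K -> T -> R) (m : K -> R) :
  iid_normal P Z ->
  noncentral_chi2 P #|K| (\sum_k m k ^+ 2) (fun w => \sum_k (Z k w + m k) ^+ 2).
Proof.
move=> ZI; have mZ := iid_normal_measurable ZI.
have mZm k : measurable_fun [set: T] (fun w => Z k w + m k).
  exact: measurable_funD.
have mS : measurable_fun [set: T] (fun w => \sum_k (Z k w + m k) ^+ 2).
  by apply: measurable_sum => k; exact: measurable_funX.
have YI := iid_normal_sub (h := @enum_val K K) (@enum_val_inj K K) ZI.
exists d, T, P, (fun i w => Z (enum_val i) w + m (enum_val i)),
  (fun i => m (enum_val i)); split.
- move=> i; split => // B mB.
  rewrite normal_probD//; case: ZI => /(_ (enum_val i)) [_ ZE] _.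
  rewrite -ZE//.
  exact: measurable_shift.
- move=> B mB; case: YI => _ /(_ (fun i => (fun x => x + m (enum_val i)) @^-1` B i)).
  by apply=> i; exact: measurable_shift.
- by rewrite [RHS](big_enum_val).
- split=> // B mB.
  rewrite [X in P (X @^-1` _)](_ : _ = fun w => \sum_(i < #|K|)
    (Z (enum_val i) w + m (enum_val i)) ^+ 2)//.
  by apply/funext => w; rewrite [LHS](big_enum_val).
Qed.

(** Numerator and denominator depend on two disjoint blocks of coordinates, hence are independent by
    [iid_normal_blocks]. *)
Lemma noncentral_F_ratio (K1 K2 : finType) (Z : K1 + K2 -> T -> R)
    (m : K1 -> R) (nu : set R -> \bar R) :
  iid_normal P Z ->
  has_law P (fun w => ((\sum_k (Z (inl k) w + m k) ^+ 2) / #|K1|%:R) /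
                      ((\sum_k Z (inr k) w ^+ 2) / #|K2|%:R)) nu ->
  noncentral_F #|K1| #|K2| (\sum_k m k ^+ 2) nu.
Proof.
move=> ZI nuE; exists d, T, P, (fun w => \sum_k (Z (inl k) w + m k) ^+ 2),
  (fun w => \sum_k Z (inr k) w ^+ 2).
have Zl : iid_normal P (fun k => Z (inl k)).
  by apply: (iid_normal_sub (h := inl)) => // ? ? [].
have Zr : iid_normal P (fun k => Z (inr k)).
  by apply: (iid_normal_sub (h := inr)) => // ? ? [].
split.
- exact: noncentral_chi2_sum.
- have := noncentral_chi2_sum (fun=> 0) Zr.
  rewrite /chi2 big1 => [|k _]; last by rewrite expr0n.
  by congr noncentral_chi2; apply/funext => w; apply: eq_bigr => k _; rewrite addr0.
- move=> A B mA mB.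
  pose C : set (coordinate_space R K1) := [set z | A (\sum_k (z k + m k) ^+ 2)].
  pose D : set (coordinate_space R K2) := [set z | B (\sum_k (z k) ^+ 2)].
  apply: (iid_normal_blocks (C := C) (D := D) ZI).
    have mf : measurable_fun setT
        (fun z : coordinate_space R K1 => \sum_k (z k + m k) ^+ 2).
      apply: measurable_sum => k; apply: measurable_funX.
      apply: measurable_funD => //.
      exact: measurable_coord.
    exact: measurable_preimage mf mA.
  have mf : measurable_fun setT
      (fun z : coordinate_space R K2 => \sum_k (z k) ^+ 2).
    by apply: measurable_sum => k; apply: measurable_funX; exact: measurable_coord.
  exact: measurable_preimage mf mB.
- exact: nuE.
Qed.

End noncentral_F_law.

(** * Independence of families as a product measure *)

Section generated_sigma_algebra.
Context {R : realType} {d : measure_display} {T : measurableType d}.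

(** The points are those of [T] with a smaller sigma-algebra, so that measurability with respect to
    [sigma_generated X] becomes ordinary measurability. *)
Definition generated_space (I : Type) (X : I -> T -> R) :=
  g_sigma_algebraType (\bigcup_i g_sigma_algebra_preimage (X i)).

HB.instance Definition _ (I : Type) (X : I -> T -> R) :=
  Measurable.on (generated_space X).

Lemma measurable_generator (I : Type) (X : I -> T -> R) (i : I) :
  measurable_fun [set: generated_space X] (X i : generated_space X -> R).
Proof.
by move=> _ B mB; apply: sub_sigma_algebra; exists i => //; exists B.
Qed.

Lemma generated_measurable (I : Type) (X : I -> T -> R) :
  (forall i, measurable_fun [set: T] (X i)) ->
  sigma_generated X `<=` measurable.
Proof.
move=> mX; apply: smallest_sub; first exact: sigma_algebra_measurable.
by move=> _ [i _ [B mB <-]]; exact: mX.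
Qed.

Lemma measurable_to_generated (I : Type) (X : I -> T -> R) :
  (forall i, measurable_fun [set: T] (X i)) ->
  measurable_fun [set: T] (id : T -> generated_space X).
Proof.
by move=> mX _ B mB; rewrite setTI; exact: (generated_measurable mX).
Qed.

Variable P : probability T R.

(* Independence says that w |-> (w, w) pushes P to a product measure on the
   product of the two generated sigma-algebras. *)
Lemma independent_families_joint (I J : Type) (X : I -> T -> R)
    (Y : J -> T -> R) (C : set (generated_space X * generated_space Y)) :
  (forall i, measurable_fun [set: T] (X i)) ->
  (forall j, measurable_fun [set: T] (Y j)) ->
  independent_families P X Y -> measurable C ->
  P [set w | C (w, w)] = (\int[P]_w P [set v | C (w, v)])%E.
Proof.
move=> mX mY XY mC.
have m1 := measurable_to_generated mX.
have m2 := measurable_to_generated mY.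
have m12 : measurable_fun [set: T]
    ((fun w => (w, w)) : T -> generated_space X * generated_space Y).
  exact: measurable_fun_pair.
pose F1 : {mfun T >-> generated_space X} :=
  HB.pack (id : T -> generated_space X) (isMeasurableFun.Build _ _ _ _ _ m1).
pose F2 : {mfun T >-> generated_space Y} :=
  HB.pack (id : T -> generated_space Y) (isMeasurableFun.Build _ _ _ _ _ m2).
pose F12 : {mfun T >-> (generated_space X * generated_space Y)%type} :=
  HB.pack ((fun w => (w, w)) : T -> (generated_space X * generated_space Y)%type)
    (isMeasurableFun.Build _ _ _ _ _ m12).
transitivity (distribution P F12 C); first by [].
have <- : (distribution P F1 \x distribution P F2)%E C = distribution P F12 C.
  by apply: product_measure_unique => // A B mA mB; exact: XY.
have xE (w : T) : xsection C w = [set v | C (w, v)].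
  by apply/seteqP; split => v /=; rewrite /xsection/= inE.
transitivity (\int[pushforward P F1]_w P [set v | C (w, v)])%E.
  by apply: eq_integral => w _; congr (P _); exact: xE.
rewrite ge0_integral_pushforward//.
apply: eq_measurable_fun (measurable_fun_xsection (distribution P F2) mC) => w _.
by congr (P _); exact: xE.
Qed.

End generated_sigma_algebra.

(** * The statistic of the PFC estimator and its conditional law *)

Section matrix_identities.
Context {R : realType}.

Lemma normF2_sum (m k : nat) (A : 'M[R]_(m, k)) :
  normF2 A = \sum_(ij : 'I_k * 'I_m) A ij.2 ij.1 ^+ 2.
Proof.
rewrite -(pair_bigA _ (fun i j => A j i ^+ 2))/=; apply: eq_bigr => i _.
by rewrite mxE; apply: eq_bigr => j _; rewrite mxE expr2.
Qed.

Lemma normF2_isometry (m k l : nat) (A : 'M[R]_(m, k)) (B : 'M[R]_(k, l)) :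
  A^T *m A = 1%:M -> normF2 (A *m B) = normF2 B.
Proof.
by move=> AA; rewrite /normF2 trmx_mul mulmxA -[_ *m A^T *m A]mulmxA AA mulmx1.
Qed.

Lemma proj_col_orthonormal (m k : nat) (G : 'M[R]_(m, k)) :
  G^T *m G = 1%:M -> proj_col G = G *m G^T.
Proof. by move=> GG; rewrite /proj_col GG invmx1 mulmx1. Qed.

(** A nonzero vector of the kernel would annul the quadratic form. *)
Lemma spd_unitmx (k : nat) (S A : 'M[R]_k) : is_spd_sqrt S A -> S \in unitmx.
Proof.
move=> [S1 S2 _]; rewrite -row_free_unit -kermx_eq0; apply/eqP/row_matrixP => i.
rewrite row0; apply/eqP; apply: contraT => v0.
have := S2 (row i (kermx S))^T; rewrite trmxK -row_mul mulmx_ker row0 mul0mx mxE.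
rewrite ltxx => H; apply: H; apply: contra v0 => /eqP/(congr1 trmx).
by rewrite trmxK trmx0 => ->.
Qed.

End matrix_identities.

Section reduced_model.
Context {R : realType} {n d q : nat}.
Variables (Gam : 'M[R]_(d + q, d)) (bet : 'M[R]_d) (sig : R).

(* This is the squared norm of A *m V, written without the square root of
   F^T F so that its measurability in F and E is clear. *)
Definition fitted_norm2 (m : nat) (A : 'M[R]_(m, d + q)) (F : 'M[R]_(n, d))
    (E : 'M[R]_(n, d + q)) : R :=
  let FF := F^T *m F in
  let N := Gam *m bet *m FF + sig *: (E^T *m F) in
  \tr (A *m N *m ((\det FF)^-1 *: \adj FF) *m (A *m N)^T).

(** With [V] the matrix to which [A] is applied on the right, the inner matrix [N] is [V *m S] and
    the inverse of [F^T *m F] is [invmx S *m invmx S], so the factors [S] cancel under the trace. *)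
Lemma fitted_norm2E (m : nat) (A : 'M[R]_(m, d + q)) (F : 'M[R]_(n, d))
    (E : 'M[R]_(n, d + q)) (S : 'M[R]_d) : is_spd_sqrt S (F^T *m F) ->
  fitted_norm2 A F E =
  normF2 (A *m (Gam *m bet *m S + sig *: (E^T *m (F *m invmx S)))).
Proof.
move=> Sspd; have Su := spd_unitmx Sspd; case: Sspd => St _ SS.
rewrite /fitted_norm2 -SS.
have SSu : S *m S \in unitmx by rewrite unitmx_mul Su.
have -> : (\det (S *m S))^-1 *: \adj (S *m S) = invmx S *m invmx S.
  rewrite -[RHS]mulmx1 -(mulmxV SSu) [invmx (S *m S)]/invmx SSu.
  rewrite mulmxA -[invmx S *m invmx S *m _]mulmxA [invmx S *m (S *m S)]mulmxA.
  by rewrite mulVmx// mul1mx mulVmx// mul1mx.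
set V := Gam *m bet *m S + _.
have -> : Gam *m bet *m (S *m S) + sig *: (E^T *m F) = V *m S.
  by rewrite mulmxDl mulmxA -scalemxAl -!mulmxA mulVmx// mulmx1.
rewrite /normF2 [RHS]mxtrace_mulC (mulmxA A V S) [(_ *m S)^T]trmx_mul St.
by rewrite !mulmxA mulmxK// mulmxKV.
Qed.

(** As the [f i] sum to zero, both [mu] and the sample mean drop out of the product of the
    transposed centered data with [rows_mx f]; the orthogonal factor of the estimator does not
    change the norm. *)
Lemma fitted_norm2_PFC (m : nat) (A : 'M[R]_(m, d + q))
    (mu : 'cV[R]_(d + q)) (f : 'I_n -> 'cV[R]_d)
    (eps X : 'I_n -> 'cV[R]_(d + q)) (Gh : 'M[R]_(d + q, d)) :
  \sum_i f i = 0 ->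
  (forall i, X i = mu + Gam *m bet *m f i + sig *: eps i) ->
  is_PFC (centered_mx X) (rows_mx f) Gh ->
  normF2 (A *m Gh) = fitted_norm2 A (rows_mx f) (rows_mx eps).
Proof.
move=> f0 XE [_ PFC].
have [S [Q [Sspd _ QQ GhE]]] := PFC erefl; rewrite GhE.
rewrite (fitted_norm2E _ _ Sspd); have Su := spd_unitmx Sspd.
case: Sspd => St _ SS.
have -> : (centered_mx X)^T *m rows_mx f =
    (Gam *m bet *m S + sig *: ((rows_mx eps)^T *m (rows_mx f *m invmx S))) *m S.
  rewrite mulmxDl -mulmxA SS -scalemxAl -!mulmxA mulVmx// mulmx1.
  apply/matrixP => a b; rewrite [LHS]mxE.
  have f0b : \sum_i f i b 0 = 0.
    by have /matrixP/(_ b 0) := f0; rewrite summxE mxE.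
  under eq_bigr => i _.
    have -> : (centered_mx X)^T a i * rows_mx f i b =
      (mu a 0 - sample_mean X a 0) * f i b 0 +
      ((Gam *m bet *m f i) a 0 * f i b 0 + sig * (eps i a 0 * f i b 0)).
      by rewrite /centered_mx /rows_mx !mxE XE !mxE; ring.
    over.
  rewrite !big_split/= -mulr_sumr f0b mulr0 add0r [RHS]mxE; congr (_ + _).
    rewrite [in RHS]mulmxA [in RHS]mulmxA [RHS]mxE; apply: eq_bigr => i _.
    rewrite [rows_mx f i b]mxE.
    by congr (_ * _); rewrite !mxE; apply: eq_bigr => l _; rewrite !mxE.
  rewrite -mulr_sumr [RHS]mxE; congr (_ * _); rewrite mxE.
  by apply: eq_bigr => i _; rewrite !mxE.
rewrite mulmxK// mulmxA; set W := A *m _.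
rewrite /normF2 [LHS]mxtrace_mulC trmx_mul mulmxA -(mulmxA W) QQ mulmx1.
by rewrite mxtrace_mulC.
Qed.

End reduced_model.

(** * The law of the ratio for a fixed F *)

Section reduction_to_noncentral_F.
Context {R : realType}.

(** A canonical non-central F variable when [z] is standard normal: the whole mean sits on
    coordinate [k0], so the parameters enter only through [L]. *)
Definition F_ratio (K1 K2 : finType) (k0 : K1) (L : R) (z : K1 + K2 -> R) : R :=
  ((\sum_k (z (inl k) + Num.sqrt L * (k == k0)%:R) ^+ 2) / #|K1|%:R) /
  ((\sum_k z (inr k) ^+ 2) / #|K2|%:R).

Lemma sum_delta_sqr (K : finType) (k0 : K) (c : R) :
  \sum_k (c * (k == k0)%:R) ^+ 2 = c ^+ 2.
Proof.
rewrite (bigD1 k0)//= eqxx mulr1 big1 ?addr0// => k /negPf ->.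
by rewrite mulr0 expr0n.
Qed.

Lemma sum_kronecker (I J : finType) (u u' : I -> R) (v v' : J -> R) :
  \sum_(ij : I * J) (u ij.1 * v ij.2) * (u' ij.1 * v' ij.2) =
  (\sum_i u i * u' i) * (\sum_j v j * v' j).
Proof.
rewrite -(pair_bigA _ (fun i j => (u i * v j) * (u' i * v' j)))/=.
rewrite mulr_suml; apply: eq_bigr => i _.
by rewrite mulr_sumr; apply: eq_bigr => j _; rewrite mulrACA.
Qed.

Lemma orthonormal_colsE (m k : nat) (A : 'M[R]_(m, k)) (x y : 'I_k) :
  A^T *m A = 1%:M -> \sum_i A i x * A i y = (x == y)%:R.
Proof.
move=> /matrixP/(_ x y); rewrite !mxE => <-.
by apply: eq_bigr => i _; rewrite mxE.
Qed.

(** An orthogonal [b] whose row [k0] points along [m] preserves the sum of squares and sends [m] to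
    its norm times the unit vector at [k0]. If [m] is zero, the identity will do. *)
Lemma mean_rotation (K : finType) (k0 : K) (m : K -> R) :
  exists b : K -> K -> R,
    (forall k l, \sum_i b k i * b l i = (k == l)%:R) /\
    forall z : K -> R, \sum_k (z k + m k) ^+ 2 =
      \sum_k (\sum_i b k i * z i +
              Num.sqrt (\sum_i m i ^+ 2) * (k == k0)%:R) ^+ 2.
Proof.
set L := \sum_i m i ^+ 2; have L0 : 0 <= L by apply: sumr_ge0 => i _; exact: sqr_ge0.
have [b [bo bs bm]] : exists b : K -> K -> R,
    [/\ forall k l, \sum_i b k i * b l i = (k == l)%:R,
        forall k l, b k l = b l k & forall k, m k = Num.sqrt L * b k0 k].
  have [L1|L1] := eqVneq L 0.
    exists (fun k l => (k == l)%:R); split => [k l|k l|k].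
    - rewrite (bigD1 k)//= eqxx mul1r big1 ?addr0 1?eq_sym// => i.
      by rewrite eq_sym => /negPf ->; rewrite mul0r.
    - by rewrite eq_sym.
    - rewrite L1 sqrtr0 mul0r; apply/eqP; rewrite -sqrf_eq0; apply/eqP.
      exact: (psumr_eq0P (fun i _ => sqr_ge0 (m i)) L1).
  have sL : Num.sqrt L != 0 by rewrite gt_eqF// sqrtr_gt0 lt_neqAle eq_sym L1.
  have u1 : \sum_k (m k / Num.sqrt L) ^+ 2 = 1.
    under eq_bigr do rewrite expr_div_n sqr_sqrtr//.
    by rewrite -mulr_suml divff.
  have [b [b1 b2 b3]] := orthonormal_unit_vector k0 u1.
  exists b; split => // k; rewrite b3 mulrC divfK//.
exists b; split => // z.
have -> : \sum_k (\sum_i b k i * z i + Num.sqrt L * (k == k0)%:R) ^+ 2 =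
    \sum_k (\sum_i b k i * (z i + m i)) ^+ 2.
  apply: eq_bigr => k _; congr (_ ^+ 2).
  under [RHS]eq_bigr do rewrite mulrDr bm mulrCA.
  by rewrite big_split/= -mulr_sumr bo.
(* Expand the squares and sum over [k] first: by the symmetry of [b] its columns are orthonormal
   too, so only the diagonal terms survive. *)
under [RHS]eq_bigr do rewrite expr2 mulr_suml.
under [RHS]eq_bigr => k _ do under eq_bigr => i _ do rewrite mulr_sumr.
rewrite [RHS]exchange_big/=; apply: eq_bigr => i _.
rewrite [RHS]exchange_big/= (bigD1 i)//= [X in _ = _ + X]big1 ?addr0 => [|j ji].
  under eq_bigr do rewrite mulrACA !(bs _ i).
  by rewrite -mulr_suml bo eqxx mul1r expr2.
under eq_bigr do rewrite mulrACA (bs _ i) (bs _ j).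
by rewrite -mulr_suml bo eq_sym (negPf ji) mul0r.
Qed.

Context {disp : measure_display} {T : measurableType disp}.
Variable P : probability T R.

Lemma fitted_ratio_law (n d q : nat) (Gam : 'M[R]_(d + q, d))
    (B : 'M[R]_(d + q, q)) (bet : 'M[R]_d) (sig : R) (F : 'M[R]_(n, d))
    (S : 'M[R]_d) (Eps : T -> 'M[R]_(n, d + q)) (k0 : 'I_d * 'I_d) :
  (0 < n)%N -> (0 < q)%N -> 0 < sig ->
  Gam^T *m Gam = 1%:M -> Gam^T *m B = 0 -> B^T *m B = 1%:M ->
  is_spd_sqrt S (F^T *m F) -> iid_normal P (entries Eps) ->
  exists2 Y : ('I_d * 'I_d) + ('I_d * 'I_q) -> T -> R, iid_normal P Y &
    forall w, q%:R * (fitted_norm2 Gam bet sig Gam^T F (Eps w) /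
                      fitted_norm2 Gam bet sig B^T F (Eps w)) / d%:R =
      F_ratio k0 (\tr (bet *m (F^T *m F) *m bet^T) / sig ^+ 2) (Y^~ w).
Proof.
move=> n0 q0 sig0 GG GB BB Sspd EI; have Su := spd_unitmx Sspd.
have d0 : (0 < d)%N by case: k0 => -[]; lia.
have [St _ SS] := Sspd.
pose H := F *m invmx S.
have HH : H^T *m H = 1%:M.
  rewrite /H trmx_mul trmx_inv St mulmxA -[_ *m F^T *m F]mulmxA -SS.
  by rewrite mulmxA mulVmx// mul1mx mulmxV.
pose K : finType := (('I_d * 'I_d) + ('I_d * 'I_q))%type.
pose y (k : K) : 'I_d := match k with inl k => k.1 | inr k => k.1 end.
pose g (k : K) (j : 'I_(d + q)) : R :=
  match k with inl k => Gam j k.2 | inr k => B j k.2 end.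
(* Tensor products of the columns of [H] with those of [Gam] and [B]; the columns of [H], and those
   of [Gam] and [B] together, are orthonormal, hence so are these. *)
pose a (k : K) (ij : 'I_n * 'I_(d + q)) := H ij.1 (y k) * g k ij.2.
have GB0 x x' : \sum_j Gam j x * B j x' = 0.
  move: GB => /matrixP/(_ x x'); rewrite !mxE => GB.
  by rewrite -[RHS]GB; apply: eq_bigr => j _; rewrite mxE.
have ao k l : \sum_ij a k ij * a l ij = (k == l)%:R.
  rewrite /a (sum_kronecker (H^~ (y k)) (H^~ (y l)) (g k) (g l)).
  rewrite orthonormal_colsE//; case: k l => [[y1 x1]|[y1 x1]] [[y2 x2]|[y2 x2]] /=.
  - by rewrite orthonormal_colsE// -natrM mulnb -xpair_eqE.
  - by rewrite GB0 mulr0.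
  - by under [X in _ * X]eq_bigr do rewrite mulrC; rewrite GB0 mulr0.
  - by rewrite orthonormal_colsE// -natrM mulnb -xpair_eqE.
pose e (k : K) w := \sum_ij a k ij * entries Eps ij w.
have eI : iid_normal P e.
  apply: iid_normal_orthonormal => //.
  by rewrite card_prod !card_ord; nia.
have eE (m : nat) (A : 'M[R]_(d + q, m)) (x : 'I_m) (y' : 'I_d) w :
    \sum_(ij : 'I_n * 'I_(d + q)) (H ij.1 y' * A ij.2 x) * entries Eps ij w =
    (A^T *m ((Eps w)^T *m H)) x y'.
  rewrite -(pair_bigA _ (fun i j => (H i y' * A j x) * Eps w i j))/= exchange_big/=.
  rewrite [RHS]mxE; apply: eq_bigr => j _; rewrite [(_ *m H) _ _]mxE mulr_sumr.
  by apply: eq_bigr => i _; rewrite !mxE; ring.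
(* The mean of the numerator block in units of [sig]; its squares add up to the non-centrality
   parameter because [S *m S = F^T *m F]. *)
pose m (k : 'I_d * 'I_d) := (bet *m S) k.2 k.1 / sig.
have sigN0 : sig != 0 by rewrite gt_eqF.
have mL : \sum_k m k ^+ 2 = \tr (bet *m (F^T *m F) *m bet^T) / sig ^+ 2.
  rewrite /m; under eq_bigr do rewrite expr_div_n.
  rewrite -mulr_suml -normF2_sum; congr (_ / _).
  by rewrite /normF2 mxtrace_mulC trmx_mul St -SS !mulmxA.
have [b [bo bm]] := mean_rotation k0 m.
(* Only the numerator block is rotated; the denominator block has no mean and stays as it is. *)
pose b' (k l : K) : R := match k, l with
  | inl k, inl l => b k l | inr k, inr l => (k == l)%:R | _, _ => 0 end.
pose Y (k : K) w := \sum_l b' k l * e l w.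
have YI : iid_normal P Y.
  apply: iid_normal_orthonormal => //.
    by rewrite card_sum !card_prod !card_ord; nia.
  move=> [k|k] [l|l]; rewrite big_sumType/= /b'.
  - by rewrite bo big1 ?addr0// => i _; rewrite mul0r.
  - by rewrite !big1 ?addr0// => i _; rewrite ?mul0r ?mulr0.
  - by rewrite !big1 ?addr0// => i _; rewrite ?mul0r ?mulr0.
  - rewrite big1 ?add0r => [|i _]; last by rewrite mul0r.
    rewrite (bigD1 k)//= eqxx mul1r big1 ?addr0 1?eq_sym// => i.
    by rewrite eq_sym => /negPf ->; rewrite mul0r.
exists Y => // w; rewrite !(fitted_norm2E _ _ _ _ _ Sspd) -/H /F_ratio -mL.
have Yl k : Y (inl k) w = \sum_i b k i * e (inl i) w.
  by rewrite /Y big_sumType/= [X in _ + X]big1 ?addr0// => i _; rewrite mul0r.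
have Yr k : Y (inr k) w = e (inr k) w.
  rewrite /Y big_sumType/= big1 ?add0r => [|i _]; last by rewrite mul0r.
  rewrite (bigD1 k)//= eqxx mul1r big1 ?addr0// => i.
  by rewrite eq_sym => /negPf ->; rewrite mul0r.
under [in RHS]eq_bigr do rewrite Yl.
under [X in _ / (X / _)]eq_bigr do rewrite Yr.
rewrite -(bm (fun k => e (inl k) w)).
have -> : normF2 (Gam^T *m (Gam *m bet *m S + sig *: ((Eps w)^T *m H))) =
    sig ^+ 2 * \sum_k (e (inl k) w + m k) ^+ 2.
  rewrite mulmxDr -!mulmxA mulmxA GG mul1mx -scalemxAr normF2_sum mulr_sumr.
  apply: eq_bigr => k _; rewrite -exprMn; congr (_ ^+ 2).
  by rewrite /e /a /= eE /m mxE [X in _ + X]mxE; field.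
have -> : normF2 (B^T *m (Gam *m bet *m S + sig *: ((Eps w)^T *m H))) =
    sig ^+ 2 * \sum_k (e (inr k) w) ^+ 2.
  have BG : B^T *m Gam = 0 by rewrite -[LHS]trmxK trmx_mul trmxK GB trmx0.
  rewrite mulmxDr -!mulmxA mulmxA BG mul0mx add0r -scalemxAr normF2_sum mulr_sumr.
  apply: eq_bigr => k _; rewrite -exprMn; congr (_ ^+ 2).
  by rewrite /e /a /= eE mxE.
(* The factors [sig ^+ 2] cancel, and so does the common factor [d] of the degrees of freedom
   [d * d] and [d * q]. *)
rewrite !card_prod !card_ord !natrM !invfM !invrK.
set U := \sum_k (_ + _) ^+ 2; move: ((\sum_k _)^-1) => W.
have dN0 : d%:R != 0 :> R by rewrite pnatr_eq0 -lt0n.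
have qN0 : q%:R != 0 :> R by rewrite pnatr_eq0 -lt0n.
by field; rewrite ?sigN0 ?dN0 ?qN0.
Qed.

End reduction_to_noncentral_F.

Section almost_everywhere.
Context {R : realType} {disp : measure_display} {T : measurableType disp}.
Variable P : probability T R.

Lemma ae_exists (Q : T -> Prop) : {ae P, forall w, Q w} -> exists w, Q w.
Proof.
move=> [N [mN N0 QN]]; apply: contrapT => nQ.
have NT : N = setT.
  by apply/seteqP; split => // w _; apply: QN => /= Qw; apply: nQ; exists w.
by move: N0; rewrite NT probability_setT => /eqP; rewrite onee_eq0.
Qed.

Lemma ae_eq_measure (A B : set T) : measurable A -> measurable B ->
  {ae P, forall w, A w <-> B w} -> P A = P B.
Proof.
have le (A' B' : set T) : measurable A' -> measurable B' ->
    {ae P, forall w, A' w <-> B' w} -> (P A' <= P B')%E.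
  move=> mA mB [N [mN N0 ABN]].
  rewrite -[leRHS]adde0 -N0.
  apply: (@le_trans _ _ (P (B' `|` N))); last exact: measureU2.
  apply: le_measure; rewrite ?inE//; first exact: measurableU.
  move=> w Aw; have [Bw|nBw] := pselect (B' w); [by left|right].
  by apply: ABN => /= -[AB _]; apply: nBw; exact: AB.
move=> mA mB AB; apply/eqP; rewrite eq_le !le//.
by apply: filterS AB => w [AB BA]; split.
Qed.

Lemma measurable_prob_section (disp1 : measure_display)
    (T1 : measurableType disp1) (C : set (T1 * T)) :
  measurable C -> measurable_fun [set: T1] (fun w => P [set v | C (w, v)]).
Proof.
move=> mC; apply: eq_measurable_fun (measurable_fun_xsection P mC) => w _.
by congr (P _); apply/seteqP; split => v /=; rewrite /xsection/= inE.
Qed.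

End almost_everywhere.

Section measurable_statistics.
Context {R : realType} {disp : measure_display} {T : measurableType disp}.

Lemma measurable_fitted_norm2 (n d q m : nat) (Gam : 'M[R]_(d + q, d))
    (bet : 'M[R]_d) (sig : R) (A : 'M[R]_(m, d + q)) (F : T -> 'M[R]_(n, d))
    (E : T -> 'M[R]_(n, d + q)) :
  mx_measurable F -> mx_measurable E ->
  measurable_fun [set: T] (fun w => fitted_norm2 Gam bet sig A (F w) (E w)).
Proof.
move=> mF mE.
have mFF : mx_measurable (fun w => (F w)^T *m F w).
  by apply: mx_measurable_mul => //; exact: mx_measurable_tr.
have mN : mx_measurable (fun w => A *m (Gam *m bet *m ((F w)^T *m F w) +
    sig *: ((E w)^T *m F w))).
  apply: mx_measurable_mul; first exact: mx_measurable_cst.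
  apply: mx_measurable_add.
    by apply: mx_measurable_mul => //; exact: mx_measurable_cst.
  apply: mx_measurable_scale => //.
  by apply: mx_measurable_mul => //; exact: mx_measurable_tr.
apply: mx_measurable_trace; apply: mx_measurable_mul; last exact: mx_measurable_tr.
apply: mx_measurable_mul => //; apply: mx_measurable_scale.
  by apply: measurable_fun_inv; exact: mx_measurable_det.
exact: mx_measurable_adj.
Qed.

Lemma measurable_normF2 (m k : nat) (M : T -> 'M[R]_(m, k)) :
  mx_measurable M -> measurable_fun [set: T] (fun w => normF2 (M w)).
Proof.
move=> mM; apply: mx_measurable_trace; apply: mx_measurable_mul => //.
exact: mx_measurable_tr.
Qed.

Lemma measurable_F_ratio (K1 K2 : finType) (k0 : K1) (L : T -> R)
    (z : K1 + K2 -> T -> R) :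
  measurable_fun [set: T] L -> (forall k, measurable_fun [set: T] (z k)) ->
  measurable_fun [set: T] (fun w => F_ratio k0 (L w) (z^~ w)).
Proof.
move=> mL mz; apply: measurable_funM.
  apply: measurable_funM => //; apply: measurable_sum => k.
  apply: measurable_funX; apply: measurable_funD => //.
  by apply: measurable_funM => //; exact: (measurableT_comp measurable_sqrt mL).
apply: measurable_fun_inv; apply: measurable_funM => //.
by apply: measurable_sum => k; exact: measurable_funX.
Qed.

End measurable_statistics.

Lemma noncentral_F_F_ratio (R : realType) (disp : measure_display)
    (T : measurableType disp) (P : probability T R) (K1 K2 : finType) (k0 : K1)
    (L : R) (Z : K1 + K2 -> T -> R) (nu : set R -> \bar R) :
  0 <= L -> iid_normal P Z -> has_law P (fun w => F_ratio k0 L (Z^~ w)) nu ->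
  noncentral_F #|K1| #|K2| L nu.
Proof.
move=> L0 ZI nuE; rewrite -[L]sqr_sqrtr// -(sum_delta_sqr k0).
exact: noncentral_F_ratio ZI nuE.
Qed.

(** * From a fixed F to the conditional law *)

Section conditional_law_of_the_ratio.
Context {R : realType} {disp : measure_display} {T : measurableType disp}.
Variable P : probability T R.

Lemma PFC_conditional_law (n d q : nat) (n_gt0 : (0 < n)%N) (d_gt0 : (0 < d)%N)
    (q_gt0 : (0 < q)%N) (mu : 'cV[R]_(d + q)) (Gam : 'M[R]_(d + q, d))
    (bet : 'M[R]_d) (sig : R) (f : 'I_n -> T -> 'cV[R]_d)
    (eps X : 'I_n -> T -> 'cV[R]_(d + q)) (Gh : T -> 'M[R]_(d + q, d))
    (F := fun w => rows_mx (fun i => f i w))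
    (Eps := fun w => rows_mx (fun i => eps i w))
    (FtF := fun w => (F w)^T *m F w)
    (Lam := fun w => \tr (bet *m FtF w *m bet^T) / sig ^+ 2)
    (stat := fun w => q%:R * fit_ratio (Gh w) Gam / d%:R) :
  Gam^T *m Gam = 1%:M -> 0 < sig ->
  mx_measurable F -> mx_measurable Gh ->
  {ae P, forall w, \sum_i f i w = 0} ->
  iid_normal P (entries Eps) ->
  independent_families P (entries F) (entries Eps) ->
  (forall i w, X i w = mu + Gam *m bet *m f i w + sig *: eps i w) ->
  {ae P, forall w, is_PFC (centered_mx (fun i => X i w)) (F w) (Gh w)} ->
  exists k : T -> probability (measurableTypeR R) R,
    conditional_law P stat (sigma_generated (entries FtF)) k /\
    forall w, noncentral_F (d * d) (d * q) (Lam w) (k w).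
Proof.
move=> GG sig0 mF mGh f0 EI FE XE PFC.
have [B [GB BB GBE]] : exists B : 'M[R]_(d + q, q),
    [/\ Gam^T *m B = 0, B^T *m B = 1%:M & Gam *m Gam^T + B *m B^T = 1%:M].
  by apply: orthonormal_completion => //; lia.
have GBc : 1%:M - Gam *m Gam^T = B *m B^T by rewrite -GBE [X in X - _]addrC addrK.
have mEps : mx_measurable Eps by move=> i j; exact: (iid_normal_measurable EI (i, j)).
pose k0 := (Ordinal d_gt0, Ordinal d_gt0).
(* The sample point is split: [w] feeds [F] and [v] feeds the errors, so that [w] can be frozen. *)
pose G w v := q%:R * (fitted_norm2 Gam bet sig Gam^T (F w) (Eps v) /
                      fitted_norm2 Gam bet sig B^T (F w) (Eps v)) / d%:R.
(* The scaling clause of the estimator supplies the square root of [FtF w], and [Gam] and [B]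
   disappear from the norms as isometries. *)
have good : {ae P, forall w, (exists S, is_spd_sqrt S (FtF w)) /\ stat w = G w w}.
  apply: filterS2 f0 PFC => w f0w PFCw; split.
    by have [_ PF] := PFCw; have [S [Q [Sspd _ _ _]]] := PF erefl; exists S.
  have fitE m (A : 'M[R]_(m, d + q)) := fitted_norm2_PFC A f0w (XE^~ w) PFCw.
  rewrite /stat /G /fit_ratio -!fitE (proj_col_orthonormal GG) GBc.
  by rewrite -!mulmxA (normF2_isometry _ GG) (normF2_isometry _ BB).
(* One good point provides a single standard normal family [Z]. The kernel at [w] is the law of the
   canonical ratio of this fixed [Z] with parameter [Lam w], so it depends on [w] through [Lam]
   only. *)
have [w0 [[S0 S0spd] _]] := ae_exists good.
have [Z ZI _] := fitted_ratio_law bet k0 n_gt0 q_gt0 sig0 GG GB BB S0spd EI.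
have mZ := iid_normal_measurable ZI.
have mFr w : measurable_fun [set: T]
    ((fun v => F_ratio k0 (Lam w) (Z^~ v)) : T -> measurableTypeR R).
  exact: measurable_F_ratio.
pose kf w : {mfun T >-> measurableTypeR R} :=
  HB.pack ((fun v => F_ratio k0 (Lam w) (Z^~ v)) : T -> measurableTypeR R)
    (isMeasurableFun.Build _ _ _ _ _ (mFr w)).
pose k w : probability (measurableTypeR R) R := distribution P (kf w).
have Lam0 w : 0 <= Lam w.
  have -> : Lam w = normF2 (F w *m bet^T) / sig ^+ 2.
    by rewrite /Lam /normF2 trmx_mul trmxK /FtF !mulmxA.
  rewrite divr_ge0 ?sqr_ge0// normF2_sum.
  by apply: sumr_ge0 => i _; exact: sqr_ge0.
have mFtF_F : @mx_measurable R _ (generated_space (entries F)) d d FtF.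
  have mFF : @mx_measurable R _ (generated_space (entries F)) n d F.
    by move=> i j; exact: (@measurable_generator _ _ _ _ (entries F) (i, j)).
  by apply: mx_measurable_mul => //; exact: mx_measurable_tr.
have mLam : measurable_fun [set: generated_space (entries FtF)]
    (Lam : generated_space (entries FtF) -> R).
  apply: measurable_funM => //; apply: mx_measurable_trace.
  apply: mx_measurable_mul; last exact: mx_measurable_cst.
  apply: mx_measurable_mul; first exact: mx_measurable_cst.
  by move=> i j; exact: (@measurable_generator _ _ _ _ (entries FtF) (i, j)).
have mFtF ij : measurable_fun [set: T] (entries FtF ij).
  by apply: (mx_measurable_mul (mx_measurable_tr mF) mF).
have mk B0 : measurable B0 -> measurable_fun [set: generated_space (entries FtF)]
    ((fun w => k w B0) : generated_space (entries FtF) -> \bar R).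
  move=> mB0.
  pose C : set (generated_space (entries FtF) * T) :=
    [set z | B0 (F_ratio k0 (Lam z.1) (Z^~ z.2))].
  suff mC : measurable C by exact: (measurable_prob_section P mC).
  apply: (measurable_preimage (f := fun z : generated_space (entries FtF) * T =>
    F_ratio k0 (Lam z.1) (Z^~ z.2))) mB0.
  apply: measurable_F_ratio => [|i]; first exact: (measurableT_comp mLam measurable_fst).
  exact: (measurableT_comp (mZ i) measurable_snd).
exists k; split; last first.
  move=> w; have : noncentral_F #|{: 'I_d * 'I_d}| #|{: 'I_d * 'I_q}| (Lam w) (k w).
    by apply: (noncentral_F_F_ratio (k0 := k0) (Lam0 w) ZI); split=> //; exact: mFr.
  by rewrite !card_prod !card_ord.
have mstat : measurable_fun [set: T] stat.
  apply: measurable_funM => //; apply: measurable_funM => //.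
  apply: measurable_funM; [|apply: measurable_fun_inv];
    apply: measurable_normF2; apply: mx_measurable_mul => //;
    exact: mx_measurable_cst.
split => //.
  by move=> B0 mB0 D mD; have := mk B0 mB0 measurableT D mD; rewrite setTI.
move=> A B0 SA mB0.
have mA : measurable A by exact: (generated_measurable mFtF).
(* [FtF] being a function of [F], the conditioning event also belongs to the sigma-algebra of [F]
   and can be attached to the first variable of [C]. *)
have SFA : sigma_generated (entries F) A.
  apply: (@generated_measurable R _ (generated_space (entries F)) _ (entries FtF) _) SA.
  by move=> ij; exact: mFtF_F.
have mG (disp1 disp2 : measure_display) (T1 : measurableType disp1)
    (T2 : measurableType disp2) (F1 : T1 -> 'M[R]_(n, d))
    (E2 : T2 -> 'M[R]_(n, d + q)) : mx_measurable F1 -> mx_measurable E2 ->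
    measurable [set z : T1 * T2 | B0 (q%:R * (
      fitted_norm2 Gam bet sig Gam^T (F1 z.1) (E2 z.2) /
      fitted_norm2 Gam bet sig B^T (F1 z.1) (E2 z.2)) / d%:R)].
  move=> mF1 mE2.
  have m1 : mx_measurable (fun z : T1 * T2 => F1 z.1).
    by move=> i j; exact: (measurableT_comp (mF1 i j) measurable_fst).
  have m2 : mx_measurable (fun z : T1 * T2 => E2 z.2).
    by move=> i j; exact: (measurableT_comp (mE2 i j) measurable_snd).
  apply: (measurable_preimage (f := fun z : T1 * T2 => q%:R * (
      fitted_norm2 Gam bet sig Gam^T (F1 z.1) (E2 z.2) /
      fitted_norm2 Gam bet sig B^T (F1 z.1) (E2 z.2)) / d%:R)) mB0.
  apply: measurable_funM => //; apply: measurable_funM => //.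
  apply: measurable_funM; first exact: measurable_fitted_norm2.
  by apply: measurable_fun_inv; exact: measurable_fitted_norm2.
pose C : set (generated_space (entries F) * generated_space (entries Eps)) :=
  [set z | A z.1 /\ B0 (G z.1 z.2)].
have mC : measurable C.
  have -> : C = fst @^-1` A `&` [set z | B0 (G z.1 z.2)] by [].
  apply: measurableI; first exact: (measurable_preimage measurable_fst).
  apply: mG => i j; first exact: (@measurable_generator _ _ _ _ (entries F) (i, j)).
  exact: (@measurable_generator _ _ _ _ (entries Eps) (i, j)).
have mGT : measurable [set z : T * T | B0 (G z.1 z.2)] by exact: mG.
have mGd : measurable [set w | A w /\ B0 (G w w)].
  apply: measurableI => //.
  have md : measurable_fun [set: T] (fun w => (w, w)) by exact: measurable_fun_pair.
  exact: (measurable_preimage md mGT).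
transitivity (P [set w | A w /\ B0 (G w w)]).
  apply: ae_eq_measure => //.
    by apply: measurableI => //; exact: measurable_preimage mstat mB0.
  by apply: filterS good => w [_ sG] /=; rewrite sG.
have -> : [set w | A w /\ B0 (G w w)] = [set w | C (w, w)] by [].
rewrite (independent_families_joint _ _ FE mC).
- transitivity (\int[P]_(w in A) P [set v | B0 (G w v)])%E.
    rewrite [RHS]integral_mkcond; apply: eq_integral => w _; rewrite patchE.
    case: ifPn => [/set_mem wA|/negP wA].
      by congr (P _); apply/seteqP; split => v //= -[].
    transitivity (P set0); last by rewrite measure0.
    congr (P _); apply/seteqP; split => // v [Aw _].
    by apply: wA; rewrite inE.
  apply: ge0_ae_eq_integral => //.
  + by apply: measurable_funTS; exact: (measurable_prob_section P mGT).
  + apply: measurable_funTS => _ D mD; rewrite setTI.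
    apply: (generated_measurable mFtF).
    by have := mk B0 mB0 measurableT D mD; rewrite setTI.
  (* For almost every frozen [w] the ratio is the canonical one of a family [Y] depending on [w];
     [Y] has the same joint law as [Z], so the probabilities agree. *)
  + apply: filterS good => w [[S Sspd] _] _.
    have [Y YI YE] := fitted_ratio_law bet k0 n_gt0 q_gt0 sig0 GG GB BB Sspd EI.
    pose Om := coordinate_space R (('I_d * 'I_d) + ('I_d * 'I_q))%type.
    have mF0 : measurable_fun [set: Om] (fun z : Om => F_ratio k0 (Lam w) z).
      apply: (@measurable_F_ratio R _ Om _ _ k0 (fun=> Lam w) (fun i z => z i)).
        exact: measurable_cst.
      exact: measurable_coord.
    have mFL := measurable_preimage mF0 mB0.
    apply: etrans (iid_normal_law YI ZI mFL).
    by congr (P _); apply/seteqP; split => v /=; rewrite /G YE.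
- by move=> ij; exact: mF.
- by move=> ij; exact: mEps.
Qed.

End conditional_law_of_the_ratio.

Theorem theorem2p4 (R : realType) (disp : measure_display)
  (T : measurableType disp) (P : probability T R)
  (n p d r : nat)
  (n_gt0 : (0 < n)%N) (d_gt0 : (0 < d)%N) (d_lt_p : (d < p)%N)
  (d_eq_r : d = r)
  (mu : 'cV[R]_p) (Gam : 'M[R]_(p, d)) (bet : 'M[R]_(d, r)) (sig : R)
  (Gam_orth : Gam^T *m Gam = 1%:M) (sig_gt0 : 0 < sig)
  (f : 'I_n -> T -> 'cV[R]_r) (eps : 'I_n -> T -> 'cV[R]_p)
  (X : 'I_n -> T -> 'cV[R]_p)
  (F := fun w : T => rows_mx (fun i => f i w))
  (Eps := fun w : T => rows_mx (fun i => eps i w))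
  (XX := fun w : T => centered_mx (fun i => X i w))
  (f_meas : forall ij, measurable_fun [set: T] (entries F ij))
  (f_sum0 : {ae P, forall w : T, \sum_i f i w = 0})
  (F_rank : {ae P, forall w : T, \rank (F w) = r})
  (eps_normal : forall ij, has_law P (entries Eps ij) (normal_prob 0 1))
  (eps_indep : mutually_independent P (entries Eps))
  (f_eps_indep : independent_families P (entries F) (entries Eps))
  (model : forall i w, X i w = mu + Gam *m bet *m f i w + sig *: eps i w)
  (Gh : T -> 'M[R]_(p, d))
  (Gh_meas : forall ij, measurable_fun [set: T] (entries Gh ij))
  (Gh_PFC : {ae P, forall w : T, is_PFC (XX w) (F w) (Gh w)})
  (FtF := fun w : T => (F w)^T *m F w)
  (Lam := fun w : T => \tr (bet *m FtF w *m bet^T) / sig ^+ 2)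
  (stat := fun w : T => (p - d)%:R * fit_ratio (Gh w) Gam / d%:R) :
  (forall w : T, stat w =
     ((p - d)%:R * normF2 (proj_col Gam *m Gh w)) /
     (d%:R * normF2 ((1%:M - proj_col Gam) *m Gh w))) /\
  exists k : T -> probability (measurableTypeR R) R,
    conditional_law P stat (sigma_generated (entries FtF)) k /\
    {ae P, forall w : T, noncentral_F (r * d) (r * (p - d)) (Lam w) (k w)}.
Proof.
subst r; split=> [w|].
  by rewrite /stat /fit_ratio invfM; ring.
(* The sum form of [p] gives the completion of [Gam] its block shape, with [q = p - d] columns. *)
have [q pE] : exists q, p = (d + q)%N.
  by exists (p - d)%N; rewrite subnKC// ltnW.
subst p; rewrite /stat !addKn.
have q_gt0 : (0 < q)%N by lia.
have mF : mx_measurable F by move=> i j; exact: (f_meas (i, j)).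
have mGh : mx_measurable Gh by move=> i j; exact: (Gh_meas (i, j)).
have [k [kcond kF]] := PFC_conditional_law n_gt0 d_gt0 q_gt0 Gam_orth sig_gt0
  mF mGh f_sum0 (conj eps_normal eps_indep) f_eps_indep model Gh_PFC.
by exists k; split=> //; exact: aeW.
Qed.
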